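(* Let $n\geq 2$ and let $W= \sqrt{1-\frac{1}{2n}}\left(\mathrm{Tr}(g)+\overline{\mathrm{Tr}(g)} \right)$, where $g$ is random from Dyson's circular symplectic ensemble with eigenvalues $x_1,\dots,x_n$ and $\mathrm{Tr}(g)=x_1+\cdots+x_n$. Then for all real $x_0$, $$\left| \mathbb{P}(W \leq x_0) - \frac{1}{\sqrt{2 \pi}} \int_{-\infty}^{x_0}e^{-\frac{x^2}{2}}\, dx \right| \leq \frac{4}{n}.$$
   Context: Dyson's circular symplectic ensemble corresponds to the symmetric space $U(2n,\mathbb{C})/USp(2n,\mathbb{C})$ with its invariant probability measure. The matrix has $n$ eigenvalues $x_1,\dots,x_n$ (each being doubly degenerate when the element is represented as a $2n\times 2n$ complex matrix, but counted once here). If $f$ depends only on the eigenvalues $x_1,\dots,x_n$, its expectation is $$\frac{2^n}{(2n)!} \int_{\mathbb{T}^n} f(x_1,\dots,x_n)\prod_{1 \leq i<j \leq n} |x_i-x_j|^4 \prod_{k=1}^n \frac{dx_k}{2 \pi},$$ where $\mathbb{T}^n=\{(x_1,\dots,x_n)\in\mathbb{C}^n: |x_i|=1\}$ and $dx_k$ denotes arc length (angular) measure on the unit circle. *)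

(* Defs.v *)
From HB Require Import structures.
From mathcomp Require Import all_boot all_order all_algebra complex.
From mathcomp Require Import all_classical all_reals all_analysis.

Set Implicit Arguments.
Unset Strict Implicit.
Unset Printing Implicit Defensive.

Import Order.TTheory GRing.Theory Num.Theory.
Import numFieldNormedType.Exports.

Local Open Scope classical_set_scope.
Local Open Scope complex_scope.
Local Open Scope ring_scope.

Definition symplJ (C : pzRingType) (n : nat) : 'M[C]_(n + n) :=
  block_mx 0 1%:M (- 1%:M) 0.

(* The quaternionic dual A^D = J A^T J^-1; note that J^T = J^-1.
   A unitary u lies in USp(2n) iff u *m qdual u = 1. *)
Definition qdual (C : pzRingType) (n : nat) (A : 'M[C]_(n + n)) :
    'M[C]_(n + n) :=
  symplJ C n *m A^T *m (symplJ C n)^T.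

(* The symmetric space U(2n) / USp(2n), realized as the self-dual unitary
   matrices: U(2n) acts transitively on them by g |-> u g u^D, and the
   stabilizer of the identity is USp(2n). *)
Definition cse_space (R : realType) (n : nat) : set 'M[R[i]]_(n + n) :=
  [set g | (g \is unitarymx) /\ qdual g = g].

(* The Borel sigma-algebra of complex matrices: the one generated by the real
   and imaginary parts of the entries. *)
Definition mx_borel (R : realType) (m : nat) : set (set 'M[R[i]]_m) :=
  <<s [set A | exists (i j : 'I_m) (B : set R), measurable B /\
        (A = [set M : 'M[R[i]]_m | B (complex.Re (M i j))] \/
         A = [set M : 'M[R[i]]_m | B (complex.Im (M i j))])] >>.

(* g is a random element of U(2n) / USp(2n) distributed according to the
   U(2n)-invariant probability measure. *)
Definition circular_symplectic_ensemble (R : realType) (d : measure_display)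
    (T : measurableType d) (P : probability T R) (n : nat)
    (g : T -> 'M[R[i]]_(n + n)) : Prop :=
  [/\ forall w, cse_space (g w),
      forall A, mx_borel A -> measurable (g @^-1` A)
    & forall (u : 'M[R[i]]_(n + n)) (A : set 'M[R[i]]_(n + n)),
        u \is unitarymx -> mx_borel A ->
        P [set w | A (u *m g w *m qdual u)] = P [set w | A (g w)] ].

(* Every eigenvalue of a self-dual matrix is doubly degenerate; x lists them
   with half of their multiplicity. *)
Definition cse_eigenvalues (R : realType) (n : nat) (g : 'M[R[i]]_(n + n))
    (x : 'I_n -> R[i]) : Prop :=
  char_poly g = (\prod_(i < n) ('X - (x i)%:P)) ^+ 2.

(* z + conj z is real; the final projection only changes its type. *)
Definition cse_W (R : realType) (n : nat) (x : 'I_n -> R[i]) : R :=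
  let tr := \sum_(i < n) x i in
  Num.sqrt (1 - (2 * n%:R)^-1) * complex.Re (tr + conjc tr).

(* Main.v *)
Require Import Defs.
From HB Require Import structures.
From mathcomp Require Import all_boot all_order all_algebra complex.
From mathcomp Require Import all_classical all_reals all_analysis.
From mathcomp Require Import measurable_realfun ring lra.

(* Stein's method by integration by parts.  Let N = 2n and let D_A be the
   derivative along the vector field g |-> A g + g A^D.  The invariance of the
   law of g under g |-> u g u^D gives E[D_A F] = 0 for skew-Hermitian A, hence,
   extending D_A complex-linearly, for every complex matrix A.  Taking
   F = f(W) g_kj and A = E_kj and summing over k and j yields
     E[f'(W) (1 - Re Tr(g^2) / N)] = E[W f(W)],
   and F = Re Tr(g^2) (g^2)_kj yields in the same way a bound on the second
   moment of Re Tr(g^2), whence E|Re Tr(g^2)| <= 4 as soon as n >= 5.  If f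
   solves Stein's equation f'(w) - w f(w) = h(w) - E h(Z), with Z standard
   normal and h an approximate step function with values in [0, 1], then
   |f'| <= 2, so |E h(W) - E h(Z)| <= 2 E|Re Tr(g^2)| / N <= 4 / n.  For n <= 4
   the bound 4 / n is at least 1 and there is nothing to prove. *)

Set Implicit Arguments.
Unset Strict Implicit.
Unset Printing Implicit Defensive.

Import Order.TTheory GRing.Theory Num.Theory.
Import numFieldNormedType.Exports.

Local Open Scope classical_set_scope.
Local Open Scope ring_scope.

(** * The Gaussian integral *)

Section gauss_tail.
Context {R : realType}.
Implicit Types w x t : R.
Notation mu := (@lebesgue_measure R).

(** The law of g is known only through its invariance, so no density is differentiated. For a
    Hermitian projection q the unitary 1 + (z - 1) q with |z| = 1 is a polynomial substitute for
    exp(i t q), and along it every F in use has a first-order expansion whose remainder is at most K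
    t^2, uniformly over the ensemble. By invariance the zeroth-order terms have equal means, so t
    |E[D F]| is at most of order t^2, and E[D F] = 0. Hermitian projections span all complex
    matrices, which gives access to the non-Hermitian E_kj.

    Smoothing the indicator costs nothing in the end: the bound on |f'| uses only 0 <= h <= 1 and
    not the slope of h, so the ramp may be made arbitrarily steep. As h has kinks, f is C^{1,1} but
    in general not C^2, and the calculus below is set up for that class.

    The factor sqrt(1 - 1/N) in W normalizes the identity: summing over the matrix units gives the
    field g the divergence (N - 1) Tr g, and (1 - 1/N) / (N - 1) = 1/N. *)

Definition gauss t : R := expR (- (t ^+ 2 / 2)).

Definition gauss_int w : R := \int[mu]_(t in `]-oo, w]) gauss t.

Lemma gauss_gt0 t : 0 < gauss t.
Proof. exact: expR_gt0. Qed.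

Lemma gauss_normal_pdf :
  gauss = (fun t => Num.sqrt (2 * pi) * normal_pdf 0 1 t).
Proof.
apply/funext => t; rewrite normal_pdfE ?oner_eq0// /normal_peak /normal_fun.
rewrite /= expr1n mul1r subr0 -[pi *+ 2]mulr_natl mulrA divff ?mul1r; last first.
  by rewrite gt_eqF// sqrtr_gt0 mulr_gt0// pi_gt0.
by rewrite /gauss mulNr.
Qed.

Lemma measurable_gauss : measurable_fun setT gauss.
Proof.
by rewrite gauss_normal_pdf; apply: measurable_funM => //; exact: measurable_normal_pdf.
Qed.

Lemma continuous_gauss : continuous gauss.
Proof.
rewrite gauss_normal_pdf => x; apply: cvgM; first exact: cvg_cst.
exact: (continuous_normal_pdf (oner_neq0 _)).
Qed.

Lemma integrable_gauss (D : set R) : measurable D ->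
  mu.-integrable D (EFin \o gauss).
Proof.
move=> mD; apply: (@integrableS _ _ _ _ setT) => //.
rewrite gauss_normal_pdf.
under [X in _.-integrable _ X]eq_fun do rewrite /= EFinM.
apply: integrableZl => //.
exact: integrable_normal_pdf.
Qed.

Lemma Rintegral_gauss : \int[mu]_t gauss t = Num.sqrt (2 * pi).
Proof.
rewrite gauss_normal_pdf RintegralZl//; last exact: integrable_normal_pdf.
by rewrite /Rintegral integral_normal_pdf/= mulr1.
Qed.

Lemma is_derive_gauss_int w : is_derive w 1 gauss_int (gauss w).
Proof.
have ww : w < w + 1 by rewrite ltrDl.
have [dI <-] := @continuous_FTC1 R gauss -oo%O w (w + 1) ww
  (integrable_gauss (measurable_itv _)) (ltNyr _) (continuous_gauss (x := w)).
by rewrite derive1E; exact/derivableP.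
Qed.

Lemma is_derive_gauss t : is_derive t 1 gauss (- (t * gauss t)).
Proof.
rewrite /gauss; by apply: is_derive_eq; rewrite /GRing.scale /=; field.
Qed.

Lemma gauss_int_ge0 w : 0 <= gauss_int w.
Proof. by apply: Rintegral_ge0 => t _; exact: ltW (gauss_gt0 t). Qed.

Lemma gauss_int_compl w :
  Num.sqrt (2 * pi) - gauss_int w = \int[mu]_(t in `[w, +oo[) gauss t.
Proof.
rewrite -Rintegral_gauss -(@Rintegral_itv_obnd_cbnd _ w +oo%O gauss); last first.
  exact: integrable_gauss.
rewrite -(@Rintegral_itvB R gauss -oo%O +oo%O)// ?set_itvNyy//.
by rewrite -set_itvNyy; exact: integrable_gauss.
Qed.

Lemma gauss_int_le w : gauss_int w <= Num.sqrt (2 * pi).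
Proof.
rewrite -subr_ge0 gauss_int_compl.
by apply: Rintegral_ge0 => t _; exact: ltW (gauss_gt0 t).
Qed.

Lemma gauss_int_oppr w : gauss_int (- w) = Num.sqrt (2 * pi) - gauss_int w.
Proof.
rewrite gauss_int_compl /gauss_int /Rintegral ge0_integration_by_substitutionNy.
- by congr fine; apply: eq_integral => t _; rewrite /gauss /= sqrrN.
- exact/continuous_subspaceT/continuous_gauss.
- by move=> t _; exact: ltW (gauss_gt0 t).
Qed.

(** Strict monotonicity allows a threshold on [w] to be traded for a threshold on [gauss_int w], the
    variable in which the ramp is linear. *)
Lemma gauss_int_lt x y : x < y -> gauss_int x < gauss_int y.
Proof.
move=> xy.
have [||c _ eq] := @MVT R gauss_int gauss x y xy.
- by move=> z _; exact: is_derive_gauss_int.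
- apply: derivable_within_continuous => z _.
  by have [] := is_derive_gauss_int z.
by rewrite -subr_gt0 eq mulr_gt0 ?gauss_gt0 ?subr_gt0.
Qed.

Lemma cvg_gauss : gauss t @[t --> +oo] --> (0 : R).
Proof.
apply: (cvg_comp (fun t : R => t ^+ 2 / 2) (fun t => expR (- t))).
  apply: gt0_cvgMly; last exact: cvgr_expr2.
  by rewrite invr_gt0.
exact: cvgr_expR.
Qed.

Lemma integral_id_gauss w : 0 <= w ->
  (\int[mu]_(t in `[w, +oo[) (t * gauss t)%:E = (gauss w)%:E)%E.
Proof.
move=> w0.
have dF t : is_derive t 1 (- gauss) (t * gauss t).
  have := is_derive_gauss t => dg.
  by rewrite -[t * _]opprK; exact: is_deriveN.
rewrite (@ge0_continuous_FTC2y R (fun t => t * gauss t) (- gauss) w 0).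
- by rewrite /= -EFinB sub0r opprK.
- by move=> t wt; rewrite mulr_ge0 ?(le_trans w0 wt)// ltW ?gauss_gt0.
- apply: continuous_subspaceT => t.
  by apply: cvgM; [exact: cvg_id|exact: continuous_gauss].
- by rewrite -oppr0; apply: cvgN; exact: cvg_gauss.
- by move=> t _; have [] := dF t.
- by apply: cvg_at_right_filter; apply: cvgN; exact: continuous_gauss.
- by move=> t _; rewrite derive1E; have [_ ->] := dF t.
Qed.

(** Mills ratio: on [[w, +oo[] one has [w * gauss t <= t * gauss t], and the right-hand side
    integrates to [gauss w]. *)
Lemma gauss_tail w : 0 <= w ->
  w * (Num.sqrt (2 * pi) - gauss_int w) <= gauss w.
Proof.
move=> w0; rewrite gauss_int_compl -RintegralZl//; last exact: integrable_gauss.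
rewrite -[leRHS]/(fine (gauss w)%:E) -integral_id_gauss//.
have mg : measurable_fun setT (fun t : R => t * gauss t).
  by apply: measurable_funM => //; exact: measurable_gauss.
apply: le_Rintegral => //.
- have := @integrableZl _ _ _ mu _ (measurable_itv `[w, +oo[) w (EFin \o gauss).
  by apply; exact: integrable_gauss.
- apply/integrableP; split.
    by apply/measurable_EFinP; exact: measurable_funTS mg.
  suff -> : (\int[mu]_(t in `[w, +oo[) `|(t * gauss t)%:E|
      = (gauss w)%:E)%E by exact: ltry.
  rewrite -integral_id_gauss//; apply: eq_integral => t.
  rewrite inE /= in_itv /= andbT => wt.
  by rewrite ger0_norm// mulr_ge0 ?(le_trans w0 wt)// ltW ?gauss_gt0.
- move=> t; rewrite /= in_itv /= andbT => wt.
  by rewrite ler_pM2r ?gauss_gt0.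
Qed.

Lemma gauss_taill w : w <= 0 -> - w * gauss_int w <= gauss w.
Proof.
move=> w0; have := @gauss_tail (- w).
rewrite oppr_ge0 gauss_int_oppr opprB addrC subrK => /(_ w0).
by rewrite /gauss sqrrN.
Qed.

End gauss_tail.

(** * Calculus of C^{1,1} functions on the line *)

Section quadratic_remainder.
Context {R : realType}.
Implicit Types f g : R -> R.

(* [f] is of class C^{1,1} with derivative [f'], in quantitative form. *)
Definition smooth11 f f' : Prop :=
  [/\ measurable_fun setT f, measurable_fun setT f' &
    forall M : R, exists K : R, forall x y : R, `|x| <= M -> `|y| <= M ->
      [/\ `|f x| <= K, `|f' x| <= K &
        `|f y - f x - f' x * (y - x)| <= K * (y - x) ^+ 2] ].

(** Since [|y - x| <= 2 * M], one factor of the quadratic remainder is absorbed in the constant. *)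
Lemma smooth11_lipschitz f f' (M K : R) :
  (forall x y : R, `|x| <= M -> `|y| <= M ->
      [/\ `|f x| <= K, `|f' x| <= K &
        `|f y - f x - f' x * (y - x)| <= K * (y - x) ^+ 2]) ->
  forall x y, `|x| <= M -> `|y| <= M ->
    `|f y - f x| <= K * (1 + 2 * M) * `|y - x|.
Proof.
move=> H x y xM yM; have [fx dfx rem] := H x y xM yM.
have K0 : 0 <= K by exact: le_trans (normr_ge0 _) fx.
have -> : f y - f x = (f y - f x - f' x * (y - x)) + f' x * (y - x) by ring.
apply: le_trans (ler_normD _ _) _.
have yx : `|y - x| <= 2 * M.
  by apply: le_trans (ler_normB _ _) _; rewrite mulr_natl mulr2n lerD.
have -> : K * (1 + 2 * M) * `|y - x| = K * (2 * M) * `|y - x| + K * `|y - x|.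
  by ring.
apply: lerD; last by rewrite normrM ler_wpM2r.
apply: le_trans rem _.
have -> : K * (y - x) ^+ 2 = K * `|y - x| * `|y - x|.
  by rewrite -real_normK ?num_real//; ring.
by rewrite ler_wpM2r// ler_wpM2l.
Qed.

Lemma smooth11M f f' g g' : smooth11 f f' -> smooth11 g g' ->
  smooth11 (fun x => f x * g x) (fun x => f' x * g x + f x * g' x).
Proof.
move=> [mf mf' Hf] [mg mg' Hg]; split.
- exact: measurable_funM.
- by apply: measurable_funD; exact: measurable_funM.
move=> M; have [K HK] := Hf M; have [L HL] := Hg M.
exists (K * L * (3 + 2 * `|M|)) => x y xM yM.
have [fx dfx remf] := HK x y xM yM.
have [gx dgx remg] := HL x y xM yM.
have [gy _ _] := HL y x yM xM.
have lipg := smooth11_lipschitz HL xM yM.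
have K0 : 0 <= K by exact: le_trans (normr_ge0 _) fx.
have L0 : 0 <= L by exact: le_trans (normr_ge0 _) gx.
have M0 : 0 <= M by exact: le_trans (normr_ge0 _) xM.
rewrite (ger0_norm M0).
have KL0 : 0 <= K * L by exact: mulr_ge0.
have KLM : 0 <= K * L * M by exact: mulr_ge0.
have fgx : `|f x * g x| <= K * L by rewrite normrM ler_pM.
have dfg : `|f' x * g x + f x * g' x| <= K * L + K * L.
  by apply: le_trans (ler_normD _ _) _; rewrite !normrM lerD// ler_pM.
split; [lra|lra|].
(* The first two terms are remainders of [f] and [g]; the third is second order by the Lipschitz
   bound on [g]. Their constants [K * L], [K * L] and [K * L * (1 + 2 * M)] add up to the
   witness. *)
have -> : f y * g y - f x * g x - (f' x * g x + f x * g' x) * (y - x) =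
  (f y - f x - f' x * (y - x)) * g y + f x * (g y - g x - g' x * (y - x))
  + f' x * (y - x) * (g y - g x) by ring.
have -> : K * L * (3 + 2 * M) * (y - x) ^+ 2 =
   K * (y - x) ^+ 2 * L + K * (L * (y - x) ^+ 2)
   + K * `|y - x| * (L * (1 + 2 * M) * `|y - x|).
  by rewrite -real_normK ?num_real//; ring.
apply: le_trans (ler_normD _ _) _; rewrite lerD//.
  by apply: le_trans (ler_normD _ _) _; rewrite !normrM lerD// ler_pM.
by rewrite !normrM ler_pM// ?mulr_ge0// ler_wpM2r.
Qed.

Lemma smooth11_comp f f' g g' : smooth11 f f' -> smooth11 g g' ->
  smooth11 (fun x => f (g x)) (fun x => f' (g x) * g' x).
Proof.
move=> [mf mf' Hf] [mg mg' Hg]; split.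
- exact: (measurableT_comp mf).
- by apply: measurable_funM => //; exact: (measurableT_comp mf').
(* [L] bounds the values of [g] on the ball of radius [M], so it is the radius on which [f] has to
   be controlled. *)
move=> M; have [L HL] := Hg M; have [K HK] := Hf L.
exists (K + K * L + K * (L * (1 + 2 * `|M|)) ^+ 2) => x y xM yM.
have [gx dgx remg] := HL x y xM yM.
have [gy _ _] := HL y x yM xM.
have lipg := smooth11_lipschitz HL xM yM.
have [fgx dfgx remf] := HK _ _ gx gy.
have K0 : 0 <= K by exact: le_trans (normr_ge0 _) fgx.
have L0 : 0 <= L by exact: le_trans (normr_ge0 _) gx.
have M0 : 0 <= M by exact: le_trans (normr_ge0 _) xM.
rewrite (ger0_norm M0).
have KL0 : 0 <= K * L by exact: mulr_ge0.
have KE : 0 <= K * (L * (1 + 2 * M)) ^+ 2 by rewrite mulr_ge0// sqr_ge0.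
have dfg : `|f' (g x) * g' x| <= K * L by rewrite normrM ler_pM.
split; [lra|lra|].
have -> : f (g y) - f (g x) - f' (g x) * g' x * (y - x) =
  (f (g y) - f (g x) - f' (g x) * (g y - g x))
  + f' (g x) * (g y - g x - g' x * (y - x)) by ring.
have d0 := sqr_ge0 (y - x).
have -> : (K + K * L + K * (L * (1 + 2 * M)) ^+ 2) * (y - x) ^+ 2 =
   K * (y - x) ^+ 2 + (K * (L * (1 + 2 * M) * `|y - x|) ^+ 2 +
   K * (L * (y - x) ^+ 2)).
  by rewrite -[(y - x) ^+ 2]real_normK ?num_real//; ring.
rewrite -[leLHS]add0r lerD ?(mulr_ge0 K0 d0)//.
apply: le_trans (ler_normD _ _) _; rewrite lerD//; last by rewrite normrM ler_pM.
apply: le_trans remf _; rewrite ler_wpM2l//.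
rewrite -[(g y - g x) ^+ 2]real_normK ?num_real// lerXn2r ?nnegrE//.
by rewrite !mulr_ge0// addr_ge0// mulr_ge0.
Qed.

Lemma smooth11D f f' g g' : smooth11 f f' -> smooth11 g g' ->
  smooth11 (fun x => f x + g x) (fun x => f' x + g' x).
Proof.
move=> [mf mf' Hf] [mg mg' Hg]; split.
- exact: measurable_funD.
- exact: measurable_funD.
move=> M; have [K HK] := Hf M; have [L HL] := Hg M.
exists (K + L) => x y xM yM.
have [fx dfx remf] := HK x y xM yM.
have [gx dgx remg] := HL x y xM yM.
split; [by apply: le_trans (ler_normD _ _) _; rewrite lerD..|].
have -> : f y + g y - (f x + g x) - (f' x + g' x) * (y - x) =
  (f y - f x - f' x * (y - x)) + (g y - g x - g' x * (y - x)) by ring.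
by rewrite mulrDl; apply: le_trans (ler_normD _ _) _; rewrite lerD.
Qed.

Lemma smooth11_cst (c : R) : smooth11 (fun=> c) (fun=> 0).
Proof.
split; [exact: measurable_cst..|] => M; exists `|c| => x y _ _.
by rewrite mul0r !subrr normr0 mulr_ge0// sqr_ge0.
Qed.

Lemma smooth11_id : smooth11 id (fun=> 1).
Proof.
split; [exact: measurable_id|exact: measurable_cst|].
move=> M; exists (`|M| + 1) => x y xM yM.
rewrite mul1r subrr !normr0 normr1 mulr_ge0 ?addr_ge0 ?sqr_ge0//.
by split => //; rewrite ?lerDr//; move: (ler_norm M); lra.
Qed.

(** The constant comes from compactness of [[- M, M]]. Two uses of the mean value theorem write the
    remainder as [f'' e * (c - x) * (y - x)] with [c] between [x] and [y]. *)
Lemma smooth11_C2 f f' f'' :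
  (forall x : R, is_derive x (1 : R) f (f' x)) ->
  (forall x : R, is_derive x (1 : R) f' (f'' x)) ->
  continuous f'' -> smooth11 f f'.
Proof.
move=> df df' cf''.
have cf : continuous f.
  by move=> x; apply/differentiable_continuous/derivable1_diffP; have [] := df x.
have cf' : continuous f'.
  by move=> x; apply/differentiable_continuous/derivable1_diffP; have [] := df' x.
split; [exact: continuous_measurable_fun..|] => M.
have bnd (h : R -> R) : continuous h ->
    exists K : R, forall x : R, `|x| <= M -> `|h x| <= K.
  move=> ch; have [M0|M0] := leP (- M) M; last first.
    exists 0 => x xM; have := le_trans (normr_ge0 _) xM; lra.
  have cn : {within `[- M, M], continuous (fun x => `|h x|)}.
    apply: continuous_subspaceT => x.
    by apply: (cvg_comp h); [exact: ch|exact: norm_continuous].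
  have [c _ Hc] := EVT_max M0 cn.
  by exists `|h c| => x; rewrite ler_norml => xM; apply: Hc; rewrite in_itv.
have [K0 H0] := bnd _ cf; have [K1 H1] := bnd _ cf'; have [K2 H2] := bnd _ cf''.
exists (`|K0| + `|K1| + `|K2|) => x y xM yM.
have := ler_norm K0; have := ler_norm K1; have := ler_norm K2.
have := H0 _ xM; have := H1 _ xM; have := H2 _ xM.
have := normr_ge0 K0; have := normr_ge0 K1; have := normr_ge0 K2.
split; [lra|lra|].
have mvt (h h' : R -> R) (a b : R) : 
    (forall x : R, is_derive x (1 : R) h (h' x)) -> a <= b ->
    exists2 c, a <= c <= b & h b - h a = h' c * (b - a).
  move=> dh ab; have [|c] := @MVT_segment _ h h' a b ab (fun x _ => dh x).
    by apply: derivable_within_continuous => z _; have [] := dh z.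
  by rewrite in_itv/=; exists c.
have seg (a b c : R) : `|a| <= M -> `|b| <= M -> a <= c <= b -> `|c| <= M.
  by rewrite !ler_norml => /andP[? ?] /andP[? ?] /andP[? ?]; apply/andP; split; lra.
have mvt' (h h' : R -> R) (a b : R) : 
    (forall x : R, is_derive x (1 : R) h (h' x)) -> `|a| <= M -> `|b| <= M ->
    exists c, [/\ `|c| <= M, `|c - a| <= `|b - a| & h b - h a = h' c * (b - a)].
  move=> dh aM bM; have [ab|/ltW ba] := leP a b.
    have [c abc eq] := mvt _ _ _ _ dh ab; exists c; split => //.
      exact: seg abc.
    move: abc => /andP[ac cb]; rewrite !ger0_norm ?subr_ge0//; lra.
  have [c abc eq] := mvt _ _ _ _ dh ba; exists c; split => //.
  - exact: seg abc.
  - move: abc => /andP[ac cb]; rewrite !ler0_norm ?subr_le0//; lra.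
  - by move: eq; lra.
have [c [cM ca eqc]] := mvt' _ _ _ _ df xM yM.
have [e [eM _ eqe]] := mvt' _ _ _ _ df' xM cM.
have -> : f y - f x - f' x * (y - x) = f'' e * (c - x) * (y - x).
  by rewrite eqc -eqe; ring.
rewrite !normrM -mulrA -[(y - x) ^+ 2]real_normK ?num_real//.
apply: ler_pM => //.
  by have := H2 _ eM; lra.
by rewrite expr2 ler_wpM2r.
Qed.

(** The one building block whose second derivative jumps: [ramp_int] is made of the identity and
    shifts of this function. *)
Lemma smooth11_pos_sqr :
  smooth11 (fun x => Num.max x 0 ^+ 2) (fun x => 2 * Num.max x 0).
Proof.
have mm : measurable_fun setT (fun x : R => Num.max x 0).
  exact: measurable_maxr.
split.
- exact: measurable_funX.
- exact: measurable_funM.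
move=> M; exists (`|M| ^+ 2 + 2 * `|M| + 1) => x y xM yM.
have MM := ler_norm M; have M0 := normr_ge0 M; have M2 := sqr_ge0 `|M|.
have mx : `|Num.max x 0| <= `|M|.
  by case: (leP x 0) => _; rewrite ?normr0//; exact: le_trans xM MM.
split.
- rewrite normrX; apply: le_trans (_ : `|M| ^+ 2 <= _); last by lra.
  by rewrite lerXn2r ?nnegrE.
- by rewrite normrM (ger0_norm (_ : 0 <= 2))//; lra.
apply: le_trans (_ : (y - x) ^+ 2 <= _); last first.
  by rewrite ler_peMl ?sqr_ge0//; lra.
have := sqr_ge0 (y - x); have := sqr_ge0 y; have := sqr_ge0 x.
have := mulr_ge0 (normr_ge0 x) (normr_ge0 y).
rewrite ler_norml; case: (leP x 0) => x0; case: (leP y 0) => y0.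
- by rewrite (ler0_norm x0) (ler0_norm y0) => *; apply/andP; split; lra.
- by rewrite (ler0_norm x0) (gtr0_norm y0) => *; apply/andP; split; lra.
- by rewrite (gtr0_norm x0) (ler0_norm y0) => *; apply/andP; split; lra.
- by rewrite (gtr0_norm x0) (gtr0_norm y0) => *; apply/andP; split; lra.
Qed.

End quadratic_remainder.

(** * Stein's equation *)

Lemma max0P (R : realType) (z : R) :
  z <= 0 /\ Num.max z 0 = 0 \/ 0 < z /\ Num.max z 0 = z.
Proof.
by have [z0|z0] := ltP 0 z; [right|left].
Qed.

Section stein.
Context {R : realType}.
Variables (a b : R).
Hypotheses (a0 : 0 <= a) (ab : a < b) (bS : b <= Num.sqrt (2 * pi)).
Implicit Types (w x y : R).

(* The step function of Stein's equation is [ramp] as a function of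
   [y = gauss_int w]: its integral against [gauss] up to [w] is then the explicit
   [ramp_int (gauss_int w)], and its total integral is [(a + b) / 2] if
   [b <= Num.sqrt (2 * pi)]. *)
Definition ramp y : R := 1 - (Num.max (y - a) 0 - Num.max (y - b) 0) / (b - a).

Definition ramp_int y : R :=
  y - (Num.max (y - a) 0 ^+ 2 - Num.max (y - b) 0 ^+ 2) / (2 * (b - a)).

Let ba_gt0 : 0 < b - a. Proof. by rewrite subr_gt0. Qed.

Lemma ramp_ge0 y : 0 <= ramp y.
Proof.
rewrite /ramp subr_ge0 ler_pdivrMr// mul1r.
have := ba_gt0.
case: (max0P (y - a)) => -[ya ->]; case: (max0P (y - b)) => -[yb ->]; lra.
Qed.

Lemma ramp_le1 y : ramp y <= 1.
Proof.
rewrite /ramp gerBl divr_ge0//; last exact: ltW.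
have := ba_gt0.
case: (max0P (y - a)) => -[ya ->]; case: (max0P (y - b)) => -[yb ->]; lra.
Qed.

Lemma ramp_eq1 y : y <= a -> ramp y = 1.
Proof.
move=> ya; have yb := le_trans ya (ltW ab).
by rewrite /ramp !max_r ?subr_le0// subrr mul0r subr0.
Qed.

Lemma ramp_eq0 y : b <= y -> ramp y = 0.
Proof.
move=> yb; have ya := le_trans (ltW ab) yb.
rewrite /ramp !max_l ?subr_ge0//.
have -> : y - a - (y - b) = b - a by ring.
by rewrite divff ?subrr// gt_eqF.
Qed.

Lemma ramp_int0 : ramp_int 0 = 0.
Proof.
have b0 := le_trans a0 (ltW ab).
by rewrite /ramp_int !max_r ?sub0r ?oppr_le0// subrr mul0r ?subr0 ?oppr0.
Qed.

Lemma ramp_int_ge y : b <= y -> ramp_int y = (a + b) / 2.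
Proof.
move=> yb; have ya := le_trans (ltW ab) yb.
rewrite /ramp_int !max_l ?subr_ge0//; field.
by rewrite gt_eqF.
Qed.

Lemma ramp_int_le y : y <= a -> ramp_int y = y.
Proof.
move=> ya; have yb := le_trans ya (ltW ab).
by rewrite /ramp_int !max_r ?subr_le0// subrr mul0r subr0.
Qed.

Lemma ramp_int_mid y : a <= y <= b ->
  ramp_int y = y - (y - a) ^+ 2 / (2 * (b - a)).
Proof.
move=> /andP[ya yb].
by rewrite /ramp_int max_l ?subr_ge0// max_r ?subr_le0// expr0n/= subr0.
Qed.

(** Expresses that [ramp_int] is an integral of [ramp], which lies between 0 and 1. The claim is
    additive over adjacent intervals, so it is checked on the three pieces cut out by [a] and [b]
    and then glued. *)
Lemma ramp_int_diff x y : x <= y -> 0 <= ramp_int y - ramp_int x <= y - x.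
Proof.
pose Q x y := 0 <= ramp_int y - ramp_int x <= y - x.
have trans x' y' z' : Q x' z' -> Q z' y' -> Q x' y'.
  by rewrite /Q => /andP[? ?] /andP[? ?]; apply/andP; split; lra.
have Ql x' y' : x' <= y' -> y' <= a -> Q x' y'.
  move=> xy ya; have xa := le_trans xy ya.
  by rewrite /Q !ramp_int_le// subr_ge0 xy lexx.
have Qr x' y' : x' <= y' -> b <= x' -> Q x' y'.
  move=> xy xb; have yb := le_trans xb xy.
  by rewrite /Q !ramp_int_ge// subrr lexx subr_ge0.
have Qm x' y' : a <= x' -> x' <= y' -> y' <= b -> Q x' y'.
  move=> ax xy yb; have ay := le_trans ax xy; have xb := le_trans xy yb.
  rewrite /Q !ramp_int_mid ?ax ?ay// -[X in _ <= X <= _]/(_ - _ - (_ - _)).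
  have -> : y' - (y' - a) ^+ 2 / (2 * (b - a)) - (x' - (x' - a) ^+ 2 / (2 * (b - a)))
    = y' - x' - (y' - x') * (y' + x' - 2 * a) / (2 * (b - a)) by ring.
  have L2 : 0 < 2 * (b - a) by rewrite mulr_gt0.
  rewrite gerBl subr_ge0 ler_pdivrMr// ler_wpM2l ?subr_ge0//=; last by lra.
  rewrite divr_ge0 ?(ltW L2)// mulr_ge0 ?subr_ge0//; lra.
have Qab x' y' : x' <= y' -> a <= x' -> Q x' y'.
  move=> xy ax; have [yb|/ltW yb] := leP y' b; first exact: Qm.
  have [xb|/ltW xb] := leP x' b; last exact: Qr.
  by apply: (trans _ _ b); [exact: Qm|exact: Qr].
move=> xy; have [ax|/ltW xa] := leP a x; first exact: Qab.
have [ya|/ltW ay] := leP y a; first exact: Ql.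
by apply: (trans _ _ a); [exact: Ql|exact: Qab].
Qed.

Lemma smooth11_ramp_int : smooth11 ramp_int ramp.
Proof.
have shift (z : R) : smooth11 (fun y => Num.max (y - z) 0 ^+ 2)
    (fun y => 2 * Num.max (y - z) 0).
  have := smooth11_comp smooth11_pos_sqr (smooth11D smooth11_id (smooth11_cst (- z))).
  by congr smooth11; apply/funext => y; rewrite addr0 mulr1.
have mulc (k : R) f f' : smooth11 f f' ->
    smooth11 (fun y => k * f y) (fun y => k * f' y).
  move=> sf; have := smooth11M (smooth11_cst k) sf.
  by congr smooth11; apply/funext => y; rewrite mul0r add0r.
have := smooth11D smooth11_id (smooth11D (mulc (- (2 * (b - a))^-1) _ _ (shift a))
  (mulc (2 * (b - a))^-1 _ _ (shift b))).
congr smooth11; apply/funext => y.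
  by rewrite /ramp_int; ring.
by rewrite /ramp; field; rewrite gt_eqF.
Qed.

(** The classical solution e^(w^2/2) times the integral over ]-oo, w] of (h - E h(Z)) e^(-t^2/2),
    for h = [ramp] after [gauss_int]; the substitution y = [gauss_int] t evaluates the integral. The
    constant (a + b) / 2 / sqrt(2 pi) is E h(Z). *)
Definition stein_fun w : R :=
  expR (w ^+ 2 / 2) *
  (ramp_int (gauss_int w) - (a + b) / 2 / Num.sqrt (2 * pi) * gauss_int w).

(** Written so that Stein's equation holds by definition; what needs proof is that this is the
    derivative of [stein_fun]. *)
Definition stein_fun' w : R :=
  w * stein_fun w + ramp (gauss_int w) - (a + b) / 2 / Num.sqrt (2 * pi).

Let S_gt0 : 0 < Num.sqrt (2 * pi) :> R.
Proof. by rewrite sqrtr_gt0 mulr_gt0// pi_gt0. Qed.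

Let mean_ge0 : 0 <= (a + b) / 2 / Num.sqrt (2 * pi).
Proof. by rewrite !divr_ge0 ?addr_ge0 ?(ltW S_gt0) ?(le_trans a0 (ltW ab)). Qed.

Let mean_le1 : (a + b) / 2 / Num.sqrt (2 * pi) <= 1.
Proof. by rewrite ler_pdivrMr// mul1r; have := ab; have := bS; lra. Qed.

Lemma expR_gauss w : expR (w ^+ 2 / 2) * gauss w = 1.
Proof. by rewrite -expRD subrr expR0. Qed.

Lemma smooth11_gauss_int : smooth11 gauss_int (@gauss R).
Proof.
apply: (@smooth11_C2 R gauss_int gauss (fun t => - (t * gauss t))
  (@is_derive_gauss_int R) (@is_derive_gauss R)).
by move=> t; apply: cvgN; apply: cvgM; [exact: cvg_id|exact: continuous_gauss].
Qed.

Lemma smooth11_expR_sqr : smooth11 (fun w : R => expR (w ^+ 2 / 2))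
  (fun w => w * expR (w ^+ 2 / 2)).
Proof.
have dE (t : R) : is_derive t (1 : R) (fun w : R => expR (w ^+ 2 / 2))
    (t * expR (t ^+ 2 / 2)).
  by apply: is_derive_eq; rewrite /GRing.scale /=; field.
have cE : continuous (fun w : R => expR (w ^+ 2 / 2)).
  by move=> x; apply/differentiable_continuous/derivable1_diffP; have [] := dE x.
apply: (@smooth11_C2 R _ _
  (fun t => expR (t ^+ 2 / 2) + t * (t * expR (t ^+ 2 / 2))) dE).
- by move=> t; apply: is_derive_eq; rewrite /GRing.scale /=; ring.
- move=> t; apply: cvgD; first exact: cE.
  apply: cvgM; first exact: cvg_id.
  by apply: cvgM; [exact: cvg_id|exact: cE].
Qed.

Lemma smooth11_stein_fun : smooth11 stein_fun stein_fun'.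
Proof.
have := smooth11M smooth11_expR_sqr
  (smooth11D (smooth11_comp smooth11_ramp_int smooth11_gauss_int)
  (smooth11M (smooth11_cst (- ((a + b) / 2 / Num.sqrt (2 * pi)))) smooth11_gauss_int)).
congr smooth11; apply/funext => w; first by rewrite /stein_fun; ring.
(* In the derivative of the integral the factor [gauss w] appears, and it cancels against
   [expR (w ^+ 2 / 2)]. *)
set m := (a + b) / 2 / _.
transitivity (w * stein_fun w +
  expR (w ^+ 2 / 2) * gauss w * (ramp (gauss_int w) - m)).
  by rewrite /stein_fun -/m; ring.
by rewrite expR_gauss /stein_fun' mul1r addrA.
Qed.

(** Both h and its mean m lie in [0, 1], so the integral of (h - m) [gauss] up to [w] is at most
    [gauss_int w] in absolute value. As the total integral vanishes, it is also at most the mass to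
    the right of [w]. The Gaussian tail bound on the side of the sign of [w] then concludes. *)
Lemma stein_fun_bound w : `|w * stein_fun w| <= 1.
Proof.
have I0 := gauss_int_ge0 w; have IS := gauss_int_le w.
have /andP[P0 PI] := ramp_int_diff I0.
have /andP[PS PIS] := ramp_int_diff IS.
rewrite ramp_int0 !subr0 in P0 PI; rewrite ramp_int_ge// in PS PIS.
have m0 := mean_ge0; have m1 := mean_le1.
set m := (a + b) / 2 / _ in m0 m1.
have mS : m * Num.sqrt (2 * pi) = (a + b) / 2 by rewrite mulfVK// gt_eqF.
rewrite /stein_fun -/m.
set I := gauss_int w in I0 IS P0 PI PS PIS *.
set S := Num.sqrt _ in IS mS PS PIS.
have mI : 0 <= m * I by exact: mulr_ge0.
have mI1 : m * I <= I by rewrite ler_piMl.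
have mSI : 0 <= m * (S - I) by rewrite mulr_ge0// subr_ge0.
have mSI1 : m * (S - I) <= S - I by rewrite ler_piMl// subr_ge0.
have F1 : `|ramp_int I - m * I| <= I by rewrite ler_norml; apply/andP; split; lra.
have F2 : `|ramp_int I - m * I| <= S - I.
  by rewrite ler_norml; apply/andP; split; lra.
rewrite -[leRHS](expR_gauss w) mulrCA normrM (ger0_norm (expR_ge0 _)).
rewrite ler_wpM2l ?expR_ge0//.
rewrite normrM; have [w0|w0] := leP w 0.
  apply: le_trans (gauss_taill w0).
  by rewrite ler0_norm// ler_wpM2l// oppr_ge0.
apply: le_trans (gauss_tail (ltW w0)).
by rewrite gtr0_norm// ler_wpM2l// ltW.
Qed.

(** The 2 is 1 for [w * stein_fun w] plus 1 for a difference of two numbers of [0, 1]. *)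
Lemma stein_fun'_bound w : `|stein_fun' w| <= 2.
Proof.
have := stein_fun_bound w; have := ramp_ge0 (gauss_int w).
have := ramp_le1 (gauss_int w); have := mean_ge0; have := mean_le1.
rewrite /stein_fun' !ler_norml => ? ? ? ? /andP[? ?]; apply/andP; split; lra.
Qed.

End stein.

(** * Quaternionic duals and Hermitian projections *)

Section quaternionic_dual.
Local Open Scope complex_scope.
Variables (C : comNzRingType) (n : nat).
Implicit Types A B M : 'M[C]_(n + n).
Local Notation J := (symplJ C n).

Lemma symplJ_tr : J^T = - J.
Proof.
by rewrite /symplJ tr_block_mx !trmx0 linearN /= trmx1 opp_block_mx !oppr0 opprK.
Qed.

Lemma symplJK : J *m J^T = 1%:M.
Proof.
rewrite /symplJ tr_block_mx !trmx0 linearN /= trmx1 mulmx_block.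
rewrite !mul0mx !mulmx0 !mul1mx mulNmx mulmxN mul1mx opprK.
by rewrite !add0r !addr0 -scalar_mx_block.
Qed.

Lemma symplJVK : J^T *m J = 1%:M.
Proof. by rewrite symplJ_tr mulNmx -mulmxN -symplJ_tr symplJK. Qed.

Lemma qdualM A B : qdual (A *m B) = qdual B *m qdual A.
Proof.
rewrite /qdual trmx_mul !mulmxA; congr (_ *m _ *m _).
by rewrite -[_ *m J^T *m J]mulmxA symplJVK mulmx1.
Qed.

Lemma qdualD A B : qdual (A + B) = qdual A + qdual B.
Proof. by rewrite /qdual linearD /= mulmxDr mulmxDl. Qed.

Lemma qdualZ c A : qdual (c *: A) = c *: qdual A.
Proof. by rewrite /qdual linearZ /= -scalemxAr -scalemxAl. Qed.

Lemma qdual_scalar (c : C) : qdual c%:M = c%:M :> 'M[C]_(n + n).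
Proof. by rewrite /qdual tr_scalar_mx scalar_mxC -mulmxA symplJK mulmx1. Qed.

Lemma mxtrace_qdual A : \tr (qdual A) = \tr A.
Proof. by rewrite /qdual mxtrace_mulC mulmxA symplJVK mul1mx mxtrace_tr. Qed.

Lemma qdualK A : qdual (qdual A) = A.
Proof.
rewrite /qdual !trmx_mul !trmxK !mulmxA.
have JJ : J *m J = - 1%:M by rewrite -symplJVK symplJ_tr mulNmx opprK.
rewrite JJ -[_ *m J^T *m J^T]mulmxA -trmx_mul JJ linearN /= trmx1.
by rewrite mulmxN !mulNmx opprK mul1mx mulmx1.
Qed.

End quaternionic_dual.

(** * Sums over the matrix units *)

Section contraction.
Local Open Scope complex_scope.
Variables (C : comNzRingType).

Lemma mxE_mul_delta m (P Q : 'M[C]_m) (k j a b : 'I_m) :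
  (P *m delta_mx k j *m Q) a b = P a k * Q j b.
Proof.
rewrite mxE (bigD1 j)//= big1 ?addr0; last first.
  move=> i ij; rewrite mxE big1 ?mul0r// => l _.
  by rewrite mxE [i == j](negbTE ij) andbF mulr0.
rewrite mxE (bigD1 k)//= big1 ?addr0; last first.
  by move=> l lk; rewrite mxE (negbTE lk) mulr0.
by rewrite mxE !eqxx mulr1.
Qed.

Lemma contract_delta m (P Q : 'M[C]_m) :
  \sum_k \sum_j (P *m delta_mx k j *m Q) k j = \tr P * \tr Q.
Proof.
rewrite /mxtrace mulr_suml; apply: eq_bigr => k _.
by rewrite mulr_sumr; apply: eq_bigr => j _; rewrite mxE_mul_delta.
Qed.

(** The dual of E_kj is J E_jk J^T, with the indices exchanged, so the two factors pair into a
    single trace instead of a product of traces. The sign is that of J^T = - J; it is the source of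
    [N - 1] and [N - 2] in the trace identities. *)
Lemma contract_qdual_delta n (P Q : 'M[C]_(n + n)) :
  \sum_k \sum_j (P *m qdual (delta_mx k j) *m Q) k j = - \tr (P *m qdual Q).
Proof.
have -> : - \tr (P *m qdual Q) = \tr (P *m symplJ C n *m ((symplJ C n)^T *m Q)^T).
  by rewrite trmx_mul trmxK /qdual !mulmxA symplJ_tr mulmxN linearN opprK.
rewrite /mxtrace; apply: eq_bigr => k _.
rewrite [RHS]mxE; apply: eq_bigr => j _.
rewrite /qdual trmx_delta !mulmxA -[_ *m trmx _ *m Q]mulmxA mxE_mul_delta.
by rewrite [X in _ = _ * X]mxE.
Qed.

Lemma contract_trace_delta m (M L : 'M[C]_m) :
  \sum_k \sum_j \tr (delta_mx k j *m M) * L k j = \tr (M *m L).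
Proof.
rewrite exchange_big /= /mxtrace; apply: eq_bigr => j _.
rewrite [RHS]mxE; apply: eq_bigr => k _; congr (_ * _).
rewrite (bigD1 k)//= big1 ?addr0; last first.
  move=> i ik; rewrite -[delta_mx _ _]mul1mx mxE_mul_delta mxE.
  by rewrite (negbTE ik) mul0r.
by rewrite -[delta_mx _ _]mul1mx mxE_mul_delta mxE eqxx mul1r.
Qed.

End contraction.

(** Polarization over the fourth roots of unity w: the weighted sums of 1, of w^2 and of |w|^2
    vanish and only [y] survives, four times. Here [x], [y], [z], [t] stand for a a^H, a b^H, b a^H,
    b b^H. *)
Lemma polarization_coef (K : comNzRingType) m (I : K) (x y z t : 'M[K]_m) :
  I * I = -1 ->
  4%:R *: y = x + 1 *: y + 1 *: z + (1 * 1) *: t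
    + I *: (x + (- I) *: y + I *: z + (I * - I) *: t)
    + (-1) *: (x + (-1) *: y + (-1) *: z + (-1 * -1) *: t)
    + (- I) *: (x + I *: y + (- I) *: z + (- I * I) *: t).
Proof.
move=> ii; apply/matrixP => k l; rewrite !mxE.
transitivity (2 * y k l + 2 * y k l * (- (I * I)) + 2 * z k l * (1 + I * I)
  + I * (I * I) * (t k l - t k l)); first by rewrite ii; ring.
by ring.
Qed.

Section hermitian_projection.
Local Open Scope complex_scope.
Context {R : realType}.
Local Notation C := R[i].
Local Notation "A ^H" := (map_mx conjc A^T) (at level 8).

Local Notation normc := (@Normc.normc R).

Lemma sqr_normcE (z : C) : normc z ^+ 2 = complex.Re (z * conjc z).
Proof.
by case: z => a b /=; rewrite sqr_sqrtr ?addr_ge0 ?sqr_ge0// mulrN opprK.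
Qed.

Lemma normc_ge0 (z : C) : 0 <= normc z.
Proof. by case: z => a b; exact: sqrtr_ge0. Qed.

Lemma normc_sum I (r : seq I) (P : pred I) (F : I -> C) :
  normc (\sum_(i <- r | P i) F i) <= \sum_(i <- r | P i) normc (F i).
Proof.
elim/big_ind2: _ => [|x x' y y' xx yy|//]; first by rewrite Normc.normc0.
exact: le_trans (le_normcD _ _) (lerD xx yy).
Qed.

Lemma Re_sum I (r : seq I) (P : pred I) (F : I -> C) :
  complex.Re (\sum_(i <- r | P i) F i) = \sum_(i <- r | P i) complex.Re (F i).
Proof.
by rewrite (big_morph (@complex.Re R) (id1 := 0) (op1 := +%R))//; case=> ? ? [].
Qed.

Lemma unitary_normc_le1 m (g : 'M[C]_m) a b :
  g \is unitarymx -> normc (g a b) <= 1.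
Proof.
move=> /unitarymxP gu.
have : (g *m map_mx conjc g^T) a a = 1 by rewrite gu mxE eqxx.
rewrite mxE => /(congr1 (@complex.Re R)); rewrite Re_sum /= => g1.
rewrite -(@expr_le1 _ 2)// ?normc_ge0// -g1 (bigD1 b)//= !mxE -sqr_normcE.
by rewrite lerDl sumr_ge0// => i _; rewrite !mxE -sqr_normcE sqr_ge0.
Qed.

Lemma unitary_normc_trace m (g : 'M[C]_m) :
  g \is unitarymx -> normc (\tr g) <= m%:R.
Proof.
move=> gu; apply: le_trans (normc_sum _ _ _) _.
rewrite -[X in _ <= X%:R]card_ord -sumr_const.
by apply: ler_sum => i _; exact: unitary_normc_le1.
Qed.

Definition herm_proj m (q : 'M[C]_m) := q^H = q /\ q *m q = q.

Lemma mx_conjM m n p (A : 'M[C]_(m, n)) (B : 'M[C]_(n, p)) : (A *m B)^H = B^H *m A^H.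
Proof. by rewrite trmx_mul map_mxM. Qed.

(** The matrix acts as [z] on the range of [q] and as 1 on its orthogonal complement. *)
Lemma unitary_phase m (q : 'M[C]_m) (z : C) : herm_proj q -> z * conjc z = 1 ->
  1%:M + (z - 1) *: q \is unitarymx.
Proof.
move=> [qH qq] z1; apply/unitarymxP.
have -> : (map_mx Num.conj (1%:M + (z - 1) *: q)^T) = 1%:M + (conjc z - 1) *: q.
  rewrite linearD linearZ /= trmx1 map_mxD map_mx1 map_mxZ qH.
  by congr (_ + _ *: _); rewrite rmorphB rmorph1.
rewrite mulmxDl mul1mx mulmxDr mulmx1 -scalemxAl -scalemxAr qq scalerA.
rewrite -addrA -!scalerDl.
set c := (c in c *: q); have -> : c = 0.
  rewrite /c; 
  have -> : conjc z - 1 + (z - 1 + (z - 1) * (conjc z - 1)) = z * conjc z - 1.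
    by ring.
  by rewrite z1 subrr.
by rewrite scale0r addr0.
Qed.

Lemma qdual_unitary n (u : 'M[C]_(n + n)) : u \is unitarymx -> qdual u \is unitarymx.
Proof.
move=> uu; have Ju : symplJ C n \is unitarymx.
  apply/unitarymxP; rewrite -[RHS](symplJK C n); congr (_ *m _).
  rewrite /symplJ tr_block_mx !trmx0 linearN /= trmx1 map_block_mx !map_mx0.
  by rewrite map_mxN map_mx1.
have uT : u^T \is unitarymx := etrans (trmx_unitary u) uu.
have JT : (symplJ C n)^T \is unitarymx := etrans (trmx_unitary _) Ju.
exact: (mul_unitarymx (mul_unitarymx Ju uT) JT).
Qed.

Lemma cse_space_act n (u M : 'M[C]_(n + n)) : u \is unitarymx ->
  cse_space M -> cse_space (u *m M *m qdual u).
Proof.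
move=> uu [Mu Mq]; split.
  exact: (mul_unitarymx (mul_unitarymx uu Mu) (qdual_unitary uu)).
by rewrite [LHS]qdualM qdualK qdualM Mq mulmxA.
Qed.

(** For nonzero [v], [r] is the squared norm of [v] and [q] the orthogonal projection onto its line;
    for [v = 0] both are 0. *)
Lemma rank1_herm_proj m (v : 'cV[C]_m) :
  exists (r : C) (q : 'M[C]_m), herm_proj q /\ v *m v^H = r *: q.
Proof.
pose r := complex.Re ((v^H *m v) 0 0).
have vv : v^H *m v = r%:C%:M.
  apply/matrixP => i j; rewrite !ord1 mxE [RHS]mxE eqxx mulr1n.
  suff im : complex.Im ((v^H *m v) 0 0) = 0.
    by rewrite /r !mxE in im *; case: (\sum_j _) im => a b /= ->.
  rewrite mxE (big_morph (@complex.Im R) (id1 := 0) (op1 := +%R))//; last first.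
    by case=> ? ? [].
  by apply: big1 => i' _; rewrite !mxE; case: (v i' 0) => a b /=; ring.
have [r0|r0] := eqVneq r 0.
  exists 0, 0; split; first by split; rewrite ?mulmx0// trmx0 map_mx0.
  rewrite scale0r; apply/matrixP => i j; rewrite [RHS]mxE mxE big_ord1.
  suff -> : v i 0 = 0 by rewrite mul0r.
  have : \sum_k normc (v k 0) ^+ 2 = 0.
    rewrite -[RHS]r0 /r mxE Re_sum; apply: eq_bigr => k _.
    by rewrite !mxE sqr_normcE mulrC.
  move/eqP; rewrite psumr_eq0; last by move=> k _; exact: sqr_ge0.
  move=> /allP /(_ i); rewrite mem_index_enum => /(_ isT) /=.
  by rewrite sqrf_eq0 => /eqP /Normc.eq0_normc.
exists r%:C, ((r^-1)%:C *: (v *m v^H)); split; last first.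
  by rewrite scalerA -rmorphM divff// scale1r.
split.
  transitivity ((r^-1)%:C *: (v *m v^H)^H).
    by rewrite linearZ /= map_mxZ; congr (_ *: _); exact: conjc_real.
  rewrite mx_conjM; congr (_ *: (_ *m _)).
  by apply/matrixP => i j; rewrite !mxE conjcK.
rewrite -scalemxAl -scalemxAr; congr (_ *: _).
rewrite mulmxA -[v *m v^H *m v]mulmxA vv -scalemx1 -scalemxAr mulmx1.
by rewrite -scalemxAl scalerA -rmorphM mulVf// scale1r.
Qed.

(* Every matrix unit is of the form [a *m b^H], which by polarization is a
   combination of multiples of Hermitian projections. *)
Lemma herm_proj_span m (f : 'M[C]_m -> C) :
  (forall c A B, f (c *: A + B) = c * f A + f B) ->
  (forall q, herm_proj q -> f q = 0) -> forall A, f A = 0.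
Proof.
move=> flin fq.
have f0 : f 0 = 0 by apply: fq; split; rewrite ?mulmx0// trmx0 map_mx0.
have fZ c A : f (c *: A) = c * f A by have := flin c A 0; rewrite !addr0 f0 addr0.
have fD A B : f (A + B) = f A + f B by have := flin 1 A B; rewrite scale1r mul1r.
have fvv (v : 'cV[C]_m) : f (v *m v^H) = 0.
  by have [r [q [hq ->]]] := rank1_herm_proj v; rewrite fZ fq// mulr0.
have fab (a b : 'cV[C]_m) : f (a *m b^H) = 0.
  have pol (I : C) : conjc I = - I -> I * I = -1 -> (4%:R : C) *: (a *m b^H) =
      (a + b) *m (a + b)^H + I *: ((a + I *: b) *m (a + I *: b)^H)
      + (- 1) *: ((a + (- 1) *: b) *m (a + (- 1) *: b)^H)
      + (- I) *: ((a + (- I) *: b) *m (a + (- I) *: b)^H).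
    move=> cI ii.
    have ex (w w' : C) : conjc w = w' ->
        (a + w *: b) *m (a + w *: b)^H = a *m a^H + w' *: (a *m b^H)
        + w *: (b *m a^H) + (w * w') *: (b *m b^H).
      move=> ww; have -> : (a + w *: b)^H = a^H + w' *: b^H.
        by rewrite -ww linearD linearZ /= map_mxD map_mxZ.
      rewrite mulmxDl !mulmxDr -!scalemxAr -!scalemxAl scalerA.
      by rewrite [w' * w]mulrC !addrA.
    have cN (z : C) : conjc (- z) = - conjc z by case: z.
    have cN1 : conjc (-1 : C) = -1 by rewrite cN conjc1.
    have cNI : conjc (- I) = I by rewrite cN cI opprK.
    have e1 := ex _ _ (conjc1 R); rewrite scale1r in e1.
    have e2 := ex _ _ cI; have e3 := ex _ _ cN1; have e4 := ex _ _ cNI.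
    by rewrite e1 e2 e3 e4; exact: polarization_coef.
  have cI : conjc 'i = - 'i :> C.
    by apply/eqP; rewrite eq_complex /= oppr0 !eqxx.
  have ii : 'i * 'i = -1 :> C by rewrite -expr2 sqr_i.
  have := pol _ cI ii; move: 'i => I polI.
  have : 4%:R * f (a *m b^H) = 0.
    have fL x y z t : f x = 0 -> f y = 0 -> f z = 0 -> f t = 0 ->
        f (x + I *: y + (-1) *: z + (- I) *: t) = 0.
      by rewrite !fD !fZ => -> -> -> ->; rewrite !mulr0 !addr0.
    by rewrite -fZ polI; apply: fL; exact: fvv.
  by move/eqP; rewrite mulf_eq0 pnatr_eq0 /= => /eqP.
have fsum (I : finType) (F : I -> 'M[C]_m) : f (\sum_i F i) = \sum_i f (F i).
  by apply: (big_morph f fD f0).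
move=> A; rewrite [A]matrix_sum_delta fsum big1// => i _; rewrite fsum big1// => j _.
rewrite fZ; 
have -> : delta_mx i j =
    (delta_mx i 0 : 'cV[C]_m) *m (delta_mx j 0 : 'cV[C]_m)^H.
  rewrite trmx_delta map_delta_mx.
  by rewrite mul_delta_mx.
by rewrite fab mulr0.
Qed.

End hermitian_projection.

(** * Measurable observables and their expectations *)

(* [g_sigma_algebraType] only accepts pointed types. *)
HB.instance Definition _ (R : realType) := isPointed.Build R[i] 0.

Section complex_measurable.
Local Open Scope complex_scope.
Context {R : realType} {d : measure_display} {T : measurableType d}.
Local Notation C := R[i].
Implicit Types F G : T -> C.

Definition cmeasurable F :=
  measurable_fun setT (fun w => complex.Re (F w)) /\
  measurable_fun setT (fun w => complex.Im (F w)).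

Lemma cmeasurable_cst (c : C) : cmeasurable (fun=> c).
Proof. by split; exact: measurable_cst. Qed.

Lemma cmeasurableD F G : cmeasurable F -> cmeasurable G ->
  cmeasurable (fun w => F w + G w).
Proof.
move=> [F1 F2] [G1 G2]; split.
- rewrite (_ : (fun w => _) =
      (fun w => complex.Re (F w)) \+ (fun w => complex.Re (G w))).
    exact: measurable_funD.
  by apply/funext => w /=; case: (F w) (G w) => ? ? [].
- rewrite (_ : (fun w => _) =
      (fun w => complex.Im (F w)) \+ (fun w => complex.Im (G w))).
    exact: measurable_funD.
  by apply/funext => w /=; case: (F w) (G w) => ? ? [].
Qed.

Lemma cmeasurableM F G : cmeasurable F -> cmeasurable G ->
  cmeasurable (fun w => F w * G w).
Proof.
move=> [F1 F2] [G1 G2]; split.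
- rewrite (_ : (fun w => _) = (fun w => complex.Re (F w) * complex.Re (G w)
    - complex.Im (F w) * complex.Im (G w))).
    by apply: measurable_funB; exact: measurable_funM.
  by apply/funext => w /=; case: (F w) (G w) => ? ? [].
- rewrite (_ : (fun w => _) = (fun w => complex.Re (F w) * complex.Im (G w)
    + complex.Im (F w) * complex.Re (G w))).
    by apply: measurable_funD; exact: measurable_funM.
  by apply/funext => w /=; case: (F w) (G w) => ? ? [].
Qed.

Lemma cmeasurable_conj F : cmeasurable F -> cmeasurable (fun w => conjc (F w)).
Proof.
move=> [F1 F2]; split.
- rewrite (_ : (fun w => _) = (fun w => complex.Re (F w)))//.
  by apply/funext => w /=; case: (F w).
- rewrite (_ : (fun w => _) = (fun w => - complex.Im (F w))).
    exact: measurable_funN.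
  by apply/funext => w /=; case: (F w).
Qed.

Lemma cmeasurable_sum I (r : seq I) (F : I -> T -> C) :
  (forall i, cmeasurable (F i)) -> cmeasurable (fun w => \sum_(i <- r) F i w).
Proof.
move=> mF; elim: r => [|i r IH].
  rewrite (_ : (fun w => _) = fun=> 0); first exact: cmeasurable_cst.
  by apply/funext => w; rewrite big_nil.
rewrite (_ : (fun w => _) = (fun w => F i w + \sum_(i <- r) F i w)).
  exact: cmeasurableD.
by apply/funext => w; rewrite big_cons.
Qed.

Lemma cmeasurable_comp_Re (f : R -> R) F : measurable_fun setT f ->
  cmeasurable F -> cmeasurable (fun w => (f (complex.Re (F w)))%:C).
Proof.
move=> mf [F1 _]; split; last exact: measurable_cst.
exact: (measurableT_comp mf).
Qed.

End complex_measurable.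

Section matrix_borel.
Local Open Scope complex_scope.
Context {R : realType} (m : nat).
Local Notation C := R[i].

(** The generators of [mx_borel], isolated so that the matrices become a measurable type whose
    measurable sets are convertible to those of the statement. *)
Definition mx_cylinders : set (set 'M[C]_m) :=
  [set A | exists (i j : 'I_m) (B : set R), measurable B /\
        (A = [set M : 'M[R[i]]_m | B (complex.Re (M i j))] \/
         A = [set M : 'M[R[i]]_m | B (complex.Im (M i j))])].

Local Notation borel_mx := (g_sigma_algebraType mx_cylinders).

Lemma cmeasurable_entry i j : cmeasurable (fun M : borel_mx => (M : 'M[C]_m) i j).
Proof.
split=> _ B mB; rewrite setTI; apply: sub_sigma_algebra; exists i, j, B.
  by split => //; left.
by split => //; right.
Qed.

Lemma measurable_borel_mx d (T : measurableType d) (f : T -> borel_mx) :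
  (forall i j, cmeasurable (fun w => (f w : 'M[C]_m) i j)) -> measurable_fun setT f.
Proof.
move=> mf; apply: (@measurability _ _ T borel_mx setT f mx_cylinders) => //.
move=> _ [_ [i [j [B [mB [-> | ->]]]] <-]]; have [m1 m2] := mf i j.
  exact: m1.
exact: m2.
Qed.

End matrix_borel.

Lemma measurable_mx_act (R : realType) n (u : 'M[R[i]]_(n + n)) :
  measurable_fun setT ((fun M => u *m M *m qdual u) :
    g_sigma_algebraType (@mx_cylinders R (n + n)) ->
    g_sigma_algebraType (@mx_cylinders R (n + n))).
Proof.
apply: measurable_borel_mx => i j.
rewrite (_ : (fun M => _) = (fun M : g_sigma_algebraType (@mx_cylinders R (n + n)) =>
    \sum_l (\sum_k u i k * (M : 'M[R[i]]_(n + n)) k l) * qdual u l j)).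
  apply: cmeasurable_sum => l; apply: cmeasurableM; last exact: cmeasurable_cst.
  apply: cmeasurable_sum => k; apply: cmeasurableM; first exact: cmeasurable_cst.
  exact: cmeasurable_entry.
by apply/funext => M; rewrite mxE; apply: eq_bigr => l _; rewrite mxE.
Qed.

Notation borel_mx R m := (g_sigma_algebraType (@mx_cylinders R m)).

Section expectation.
Local Open Scope complex_scope.
Context {R : realType} {d : measure_display} {T : measurableType d}.
Variables (P : probability T R) (n : nat) (g : T -> 'M[R[i]]_(n + n)).
Hypothesis gE : circular_symplectic_ensemble P g.
Local Notation C := R[i].
Local Notation mat := 'M[C]_(n + n).
Local Notation normc := (@Normc.normc R).
Implicit Types F G : mat -> C.

(** Boundedness is asked only on [cse_space], where [g] takes its values: matrix entries are bounded
    there by unitarity, but not on all matrices. *)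
Definition observable F :=
  @cmeasurable R _ (borel_mx R (n + n)) F /\
  exists K : R, forall M, cse_space M -> normc (F M) <= K.

Definition expect F : C :=
  (\int[P]_w complex.Re (F (g w))) +i* (\int[P]_w complex.Im (F (g w))).

Lemma normc_ge_absRe (z : C) : `|complex.Re z| <= normc z.
Proof.
by case: z => a b /=; rewrite -sqrtr_sqr ler_wsqrtr// lerDl sqr_ge0.
Qed.

Lemma normc_ge_absIm (z : C) : `|complex.Im z| <= normc z.
Proof.
by case: z => a b /=; rewrite -sqrtr_sqr ler_wsqrtr// lerDr sqr_ge0.
Qed.

Lemma normc_real (r : R) : normc r%:C = `|r|.
Proof. by rewrite /= expr0n/= addr0 sqrtr_sqr. Qed.

Lemma normc_conj (z : C) : normc (conjc z) = normc z.
Proof. by case: z => a b /=; rewrite sqrrN. Qed.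

Lemma observable_cst c : observable (fun=> c).
Proof. by split; [exact: cmeasurable_cst|exists (normc c)]. Qed.

Lemma observable_conj F : observable F -> observable (fun M => conjc (F M)).
Proof.
move=> [mF [K FK]]; split; first exact: cmeasurable_conj.
by exists K => M gM; rewrite normc_conj; exact: FK.
Qed.

Lemma observableD F G : observable F -> observable G ->
  observable (fun M => F M + G M).
Proof.
move=> [mF [K FK]] [mG [L GL]]; split; first exact: cmeasurableD.
exists (K + L) => M gM; apply: le_trans (le_normcD _ _) _.
by rewrite lerD ?FK ?GL.
Qed.

Lemma observableM F G : observable F -> observable G ->
  observable (fun M => F M * G M).
Proof.
move=> [mF [K FK]] [mG [L GL]]; split; first exact: cmeasurableM.
by exists (K * L) => M gM; rewrite Normc.normcM ler_pM ?normc_ge0 ?FK ?GL.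
Qed.

Lemma observable_sum I (r : seq I) (F : I -> mat -> C) :
  (forall i, observable (F i)) -> observable (fun M => \sum_(i <- r) F i M).
Proof.
move=> oF; elim: r => [|i r IH].
  rewrite (_ : (fun w => _) = fun=> 0); first exact: observable_cst.
  by apply/funext => w; rewrite big_nil.
rewrite (_ : (fun w => _) = (fun w => F i w + \sum_(i <- r) F i w)).
  exact: observableD.
by apply/funext => w; rewrite big_cons.
Qed.

Lemma observable_entry i j : observable (fun M => M i j).
Proof.
split; first exact: cmeasurable_entry.
by exists 1 => M [gM _]; exact: unitary_normc_le1.
Qed.

Lemma observable_comp_Re (f : R -> R) F : measurable_fun setT f ->
  (forall K : R, exists L : R, forall x : R, `|x| <= K -> `|f x| <= L) ->
  observable F -> observable (fun M => (f (complex.Re (F M)))%:C).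
Proof.
move=> mf bf [mF [K FK]]; split; first exact: cmeasurable_comp_Re.
have [L fL] := bf K; exists L => M gM; rewrite normc_real fL//.
by apply: le_trans (normc_ge_absRe _) _; exact: FK.
Qed.

Lemma observable_act F u : u \is unitarymx -> observable F ->
  observable (fun M => F (u *m M *m qdual u)).
Proof.
move=> uu [[m1 m2] [K FK]]; split; last first.
  by exists K => M gM; apply: FK; exact: cse_space_act.
split; [exact: (measurableT_comp m1 (measurable_mx_act u))|].
exact: (measurableT_comp m2 (measurable_mx_act u)).
Qed.

Lemma measurable_ensemble :
  measurable_fun setT (g : T -> borel_mx R (n + n)).
Proof.
by have [_ mg _] := gE; move=> _ A mA; rewrite setTI; apply: mg.
Qed.

Lemma bounded_integrable (X : T -> R) (K : R) : measurable_fun setT X ->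
  (forall w, `|X w| <= K) -> P.-integrable setT (EFin \o X).
Proof.
move=> mX XK; apply: measurable_bounded_integrable => //.
  by apply: le_lt_trans (probability_le1 _ _) (ltry _).
exists K; split; first exact: num_real.
by move=> y Ky w _; exact: le_trans (XK w) (ltW Ky).
Qed.

Lemma observable_Re_integrable F : observable F ->
  P.-integrable setT (EFin \o (fun w => complex.Re (F (g w)))).
Proof.
move=> [[mF _] [K FK]]; have [gC _ _] := gE; apply: (@bounded_integrable _ K).
  exact: (measurableT_comp mF measurable_ensemble).
by move=> w; apply: le_trans (normc_ge_absRe _) _; exact: FK.
Qed.

Lemma observable_Im_integrable F : observable F ->
  P.-integrable setT (EFin \o (fun w => complex.Im (F (g w)))).
Proof.
move=> [[_ mF] [K FK]]; have [gC _ _] := gE; apply: (@bounded_integrable _ K).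
  exact: (measurableT_comp mF measurable_ensemble).
by move=> w; apply: le_trans (normc_ge_absIm _) _; exact: FK.
Qed.

Lemma expectD F G : observable F -> observable G ->
  expect (fun M => F M + G M) = expect F + expect G.
Proof.
move=> oF oG; rewrite /expect; apply/eqP; rewrite eq_complex /=; apply/andP; split.
- rewrite -RintegralD//; [|exact: observable_Re_integrable..].
  by apply/eqP; apply: eq_Rintegral => w _ /=; case: (F (g w)) (G (g w)) => ? ? [].
- rewrite -RintegralD//; [|exact: observable_Im_integrable..].
  by apply/eqP; apply: eq_Rintegral => w _ /=; case: (F (g w)) (G (g w)) => ? ? [].
Qed.

Lemma expectZ c F : observable F -> expect (fun M => c * F M) = c * expect F.
Proof.
move=> oF; case: c => a b.
have iR := observable_Re_integrable oF; have iI := observable_Im_integrable oF.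
have iZ (k : R) (X : T -> R) : P.-integrable setT (EFin \o X) ->
    P.-integrable setT (EFin \o (fun w => k * X w)).
  by move=> iX; have := @integrableZl _ _ _ P _ measurableT k (EFin \o X) iX.
rewrite /expect; apply/eqP; rewrite eq_complex /=; apply/andP; split.
- rewrite -!RintegralZl// -RintegralB//; [|exact: iZ..].
  by apply/eqP; apply: eq_Rintegral => w _ /=; case: (F (g w)).
- rewrite -!RintegralZl// -RintegralD//; [|exact: iZ..].
  by apply/eqP; apply: eq_Rintegral => w _ /=; case: (F (g w)).
Qed.

Lemma eq_expect F G : (forall M, cse_space M -> F M = G M) -> expect F = expect G.
Proof.
move=> FG; have [gC _ _] := gE; rewrite /expect.
by congr (_ +i* _); apply: eq_Rintegral => w _; rewrite FG.
Qed.

Lemma expect0 : expect (fun=> 0) = 0.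
Proof.
by rewrite -[RHS](mul0r (expect (fun=> 0))) -expectZ ?mul0r//; exact: observable_cst.
Qed.

Lemma expect_sum I (r : seq I) (F : I -> mat -> C) :
  (forall i, observable (F i)) ->
  expect (fun M => \sum_(i <- r) F i M) = \sum_(i <- r) expect (F i).
Proof.
move=> oF; elim: r => [|i r IH].
  by rewrite big_nil -[RHS]expect0; apply: eq_expect => M _; rewrite big_nil.
rewrite big_cons -IH -expectD//; last exact: observable_sum.
by apply: eq_expect => M _; rewrite big_cons.
Qed.

(** Invariance is assumed for Borel events, that is, [g] and [u g u^D] have the same image measure.
    Both expectations are rewritten as integrals against that measure. *)
Lemma expect_invariant F u : observable F -> u \is unitarymx ->
  expect (fun M => F (u *m M *m qdual u)) = expect F.
Proof.
move=> oF uu; have [gC mg ginv] := gE.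
pose h w : borel_mx R (n + n) := u *m g w *m qdual u.
have mh : measurable_fun setT h.
  exact: (measurableT_comp (measurable_mx_act u) measurable_ensemble).
have ch w : cse_space (h w) by exact: cse_space_act.
have [mF [K FK]] := oF; have [mR mI] := mF.
have same (X : borel_mx R (n + n) -> R) : measurable_fun setT X ->
    (forall M, cse_space M -> `|X M| <= K) ->
    \int[P]_w X (h w) = \int[P]_w X (g w).
  move=> mX XK; rewrite /Rintegral; congr fine.
  have iX (k : T -> borel_mx R (n + n)) : measurable_fun setT k ->
      (forall w, cse_space (k w)) -> P.-integrable setT ((EFin \o X) \o k).
    move=> mk ck; have := @bounded_integrable (X \o k) K; apply.
      exact: (measurableT_comp mX mk).
    by move=> w; exact: XK.
  have mEX : measurable_fun setT (EFin \o X) by exact/measurable_EFinP.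
  have := @integral_pushforward _ _ _ _ _ h mh P setT _ mEX (iX h mh ch) measurableT.
  rewrite preimage_setT => <-.
  have := @integral_pushforward _ _ _ _ _ (g : T -> borel_mx R (n + n))
    measurable_ensemble P setT _ mEX (iX _ measurable_ensemble gC) measurableT.
  rewrite preimage_setT => <-.
  apply: eq_measure_integral; first exact: measurable_ensemble.
  by move=> mg' A mA _; exact: (ginv u A uu mA).
rewrite /expect; congr (_ +i* _).
- by apply: (same _ mR) => M gM; apply: le_trans (normc_ge_absRe _) _; exact: FK.
- by apply: (same _ mI) => M gM; apply: le_trans (normc_ge_absIm _) _; exact: FK.
Qed.

Lemma le_norm_expect F (K : R) : observable F ->
  (forall M, cse_space M -> normc (F M) <= K) ->
  `|complex.Re (expect F)| <= K /\ `|complex.Im (expect F)| <= K.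
Proof.
move=> oF FK; have [gC _ _] := gE.
have bnd (X : T -> R) : P.-integrable setT (EFin \o X) ->
    (forall w, `|X w| <= K) -> `|\int[P]_w X w| <= K.
  move=> iX XK; apply: le_trans (le_normr_Rintegral _ iX) _ => //.
  have -> : K = \int[P]_(w in setT) cst K w.
    rewrite Rintegral_cst// -[LHS]mulr1; congr (_ * _).
    exact: (esym (congr1 fine (probability_setT P))).
  have iN : P.-integrable setT (EFin \o (fun w => `|X w|)).
    have [mX _] := integrableP _ _ _ iX.
    apply: (@bounded_integrable _ K).
      by apply: measurableT_comp => //; exact/measurable_EFinP.
    by move=> w; rewrite normr_id.
  have iK : P.-integrable setT (EFin \o (cst K : T -> R)).
    by apply: (@bounded_integrable _ `|K|); first exact: measurable_cst.
  exact: (le_Rintegral measurableT iN iK (fun w _ => XK w)).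
split.
- apply: bnd => [|w]; first exact: observable_Re_integrable.
  by apply: le_trans (normc_ge_absRe _) _; exact: FK.
- apply: bnd => [|w]; first exact: observable_Im_integrable.
  by apply: le_trans (normc_ge_absIm _) _; exact: FK.
Qed.

End expectation.

(** * Derivations and integration by parts *)

Section derivation.
Local Open Scope complex_scope.
Context {R : realType} (n : nat).
Local Notation C := R[i].
Local Notation mat := 'M[C]_(n + n).
Local Notation normc := (@Normc.normc R).
Implicit Types F G : mat -> C.

(** Parametrizing the circle by its imaginary part avoids trigonometric functions; it agrees with
    e^(i t) to first order at 0, and only that matters. *)
Definition unit_phase (t : R) : C := Num.sqrt (1 - t ^+ 2) +i* t.

Definition phase_mx (q : mat) (t : R) : mat := 1%:M + (unit_phase t - 1) *: q.

Definition flow (q : mat) (t : R) (M : mat) : mat :=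
  phase_mx q t *m M *m qdual (phase_mx q t).

Lemma unit_phase_conj t : 0 <= t <= 1 -> unit_phase t * conjc (unit_phase t) = 1.
Proof.
move=> /andP[t0 t1]; have t2 : t ^+ 2 <= 1 by rewrite expr_le1.
rewrite /unit_phase /=; apply/eqP; rewrite eq_complex /= mulrN opprK -!expr2.
by rewrite sqr_sqrtr ?subr_ge0// subrK eqxx mulrN mulrC addNr eqxx.
Qed.

Lemma phase_mx_unitary q t : herm_proj q -> 0 <= t <= 1 -> phase_mx q t \is unitarymx.
Proof. by move=> hq t01; apply: unitary_phase => //; exact: unit_phase_conj. Qed.

Lemma cse_space_flow q t M : herm_proj q -> 0 <= t <= 1 -> cse_space M ->
  cse_space (flow q t M).
Proof. by move=> hq t01; apply: cse_space_act; exact: phase_mx_unitary. Qed.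

Lemma unit_phase_taylor t : 0 <= t <= 1 ->
  [/\ normc (unit_phase t - 1 - 'i * t%:C) <= t ^+ 2 &
      normc ((unit_phase t - 1) ^+ 2) <= 2 * t ^+ 2].
Proof.
move=> /andP[t0 t1]; have t2 : t ^+ 2 <= 1 by rewrite expr_le1.
set s := Num.sqrt (1 - t ^+ 2).
have s0 : 0 <= s by exact: sqrtr_ge0.
have s2 : s ^+ 2 = 1 - t ^+ 2 by rewrite sqr_sqrtr// subr_ge0.
have t20 := sqr_ge0 t.
have s1 : s <= 1 by rewrite -(@expr_le1 _ 2)// s2; lra.
(* As 0 <= s <= 1, 1 - s <= 1 - s^2 = t^2. *)
have st : 1 - s <= t ^+ 2.
  have : s ^+ 2 <= s by rewrite expr2 ler_piMl.
  lra.
split.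
  have -> : unit_phase t - 1 - 'i * t%:C = (s - 1)%:C.
    apply/eqP; rewrite eq_complex /=.
    by apply/andP; split; apply/eqP; rewrite -/s; ring.
  rewrite normc_real ler0_norm ?subr_le0//; lra.
rewrite expr2 Normc.normcM -expr2 sqr_normcE /= -/s.
have -> : (s - 1) * (s - 1) - (t - 0) * - (t - 0) = s ^+ 2 + t ^+ 2 + 1 - 2 * s by ring.
rewrite s2; lra.
Qed.

(** A one-sided derivative at t = 0 with remainder uniform in [M], so that the expansion can be
    integrated term by term. *)
Definition diffable q F (F' : mat -> C) := exists K : R, forall M t,
  cse_space M -> 0 <= t <= 1 ->
  normc (F (flow q t M) - F M - t%:C * F' M) <= K * t ^+ 2.

Lemma diffable_lipschitz q F F' : observable F' -> diffable q F F' ->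
  exists2 K : R, 0 <= K & forall M t, cse_space M -> 0 <= t <= 1 ->
    normc (F (flow q t M) - F M) <= K * t.
Proof.
move=> [_ [L FL]] [K FK]; exists (`|K| + `|L|); first by rewrite addr_ge0.
move=> M t gM t01; have := FK M t gM t01; move: (t01) => /andP[t0 t1] h.
have -> : F (flow q t M) - F M = (F (flow q t M) - F M - t%:C * F' M) + t%:C * F' M.
  by rewrite subrK.
apply: le_trans (le_normcD _ _) _; rewrite mulrDl lerD//.
  apply: le_trans h _; apply: le_trans (_ : `|K| * t ^+ 2 <= _).
    by rewrite ler_wpM2r ?sqr_ge0// ler_norm.
  by rewrite ler_wpM2l// expr2 ler_piMl.
rewrite Normc.normcM normc_real ger0_norm// mulrC ler_wpM2r//.
exact: le_trans (FL M gM) (ler_norm _).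
Qed.

(* [dF A] is the derivative of [F] along the vector field [M |-> A M + M A^D],
   extended complex-linearly from skew-Hermitian [A]. *)
Definition derivation F (dF : mat -> mat -> C) :=
  [/\ observable F, forall A, observable (dF A),
      forall c A B M, dF (c *: A + B) M = c * dF A M + dF B M &
      forall q, herm_proj q -> diffable q F (dF ('i *: q))].

Lemma derivation_cst c : derivation (fun=> c) (fun _ _ => 0).
Proof.
split; [exact: observable_cst|by move=> A; exact: observable_cst| |].
  by move=> *; rewrite mulr0 addr0.
move=> q hq; exists 0 => M t _ _.
by rewrite mulr0 subrr subr0 Normc.normc0 mul0r.
Qed.

Lemma derivationD F dF G dG : derivation F dF -> derivation G dG ->
  derivation (fun M => F M + G M) (fun A M => dF A M + dG A M).
Proof.
move=> [oF odF lF qF] [oG odG lG qG]; split.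
- exact: observableD.
- by move=> A; exact: observableD.
- by move=> c A B M; rewrite lF lG; ring.
move=> q hq; have [K FK] := qF q hq; have [L GL] := qG q hq.
exists (K + L) => M t gM t01; cbv beta.
set f := F (flow q t M); set f0 := F M; set f' := dF _ _.
set e := G (flow q t M); set e0 := G M; set e' := dG _ _.
have -> : f + e - (f0 + e0) - t%:C * (f' + e') =
  (f - f0 - t%:C * f') + (e - e0 - t%:C * e') by ring.
by apply: le_trans (le_normcD _ _) _; rewrite mulrDl lerD ?FK ?GL.
Qed.

Lemma derivationM F dF G dG : derivation F dF -> derivation G dG ->
  derivation (fun M => F M * G M) (fun A M => dF A M * G M + F M * dG A M).
Proof.
move=> [oF odF lF qF] [oG odG lG qG]; split.
- exact: observableM.
- by move=> A; apply: observableD; exact: observableM.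
- by move=> c A B M; rewrite lF lG; ring.
move=> q hq; have [K FK] := qF q hq; have [L GL] := qG q hq.
have [_ [K0 FK0]] := oF; have [_ [K1 FK1]] := odF ('i *: q).
have [_ [L0 GL0]] := oG.
have [L2 L20 GL2] := diffable_lipschitz (odG ('i *: q)) (qG q hq).
exists (K * L0 + K0 * L + K1 * L2) => M t gM t01; cbv beta.
have := FK M t gM t01; have := GL M t gM t01.
have := FK0 M gM; have := FK1 M gM; have := GL2 M t gM t01.
have := GL0 _ (cse_space_flow hq t01 gM).
set f := F (flow q t M); set f0 := F M; set f' := dF _ _.
set e := G (flow q t M); set e0 := G M; set e' := dG _ _ => h1 h2 h3 h4 h5 h6.
(* The last term is a product of two increments of order t, the second by the Lipschitz bound on
   [G]. *)
have -> : f * e - f0 * e0 - t%:C * (f' * e0 + f0 * e') =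
  (f - f0 - t%:C * f') * e + f0 * (e - e0 - t%:C * e') + (t%:C * f') * (e - e0) by ring.
have /andP[t0 t1] := t01.
have -> : (K * L0 + K0 * L + K1 * L2) * t ^+ 2 =
  K * t ^+ 2 * L0 + K0 * (L * t ^+ 2) + t * K1 * (L2 * t) by ring.
apply: le_trans (le_normcD _ _) _; rewrite lerD//.
  apply: le_trans (le_normcD _ _) _; rewrite !Normc.normcM lerD//.
    by rewrite ler_pM ?normc_ge0.
  by rewrite ler_pM ?normc_ge0.
rewrite !Normc.normcM normc_real ger0_norm//.
by rewrite ler_pM ?mulr_ge0 ?normc_ge0// ler_wpM2l.
Qed.

(* [- A^*] is [A] for skew-Hermitian [A], and is antilinear in [A]. *)
Lemma derivation_conj F dF : derivation F dF ->
  derivation (fun M => conjc (F M))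
    (fun A M => conjc (dF (- map_mx conjc A^T) M)).
Proof.
have cD (x y : C) : conjc (x + y) = conjc x + conjc y by exact: rmorphD.
have cN (x : C) : conjc (- x) = - conjc x by case: x.
have cM (x y : C) : conjc (x * y) = conjc x * conjc y by exact: rmorphM.
move=> [oF odF lF qF]; split.
- exact: observable_conj.
- by move=> A; exact: observable_conj.
- move=> c A B M.
  have -> : - map_mx conjc (c *: A + B)^T =
      conjc c *: (- map_mx conjc A^T) + (- map_mx conjc B^T).
    by apply/matrixP => i j; rewrite !mxE cD cM opprD mulrN.
  by rewrite lF cD cM conjcK.
move=> q hq; have [K FK] := qF q hq; exists K => M t gM t01; cbv beta.
have -> : - map_mx conjc ('i *: q)^T = 'i *: q.
  have [qH _] := hq; rewrite -[in RHS]qH; apply/matrixP => i j; rewrite !mxE cM.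
  have -> : conjc 'i = - 'i :> C by apply/eqP; rewrite eq_complex /= oppr0 !eqxx.
  by rewrite mulNr opprK.
rewrite -normc_conj !cD !cN cM !conjcK conjc_real; exact: FK.
Qed.

(** The real part is treated as half of F + conj F: the real part of [dF A] would not be
    complex-linear in [A], whereas the expression used here is, and it agrees with the real part for
    skew-Hermitian [A]. *)
Lemma derivation_comp_Re (f f' : R -> R) F dF : smooth11 f f' -> derivation F dF ->
  derivation (fun M => (f (complex.Re (F M)))%:C)
    (fun A M => (f' (complex.Re (F M)))%:C *
       ((dF A M + conjc (dF (- map_mx conjc A^T) M)) / 2)).
Proof.
move=> [mf mf' Hf] dFF.
have half : derivation (fun=> (2^-1 : C)) (fun _ _ => 0) by exact: derivation_cst.
have := derivationM (derivationD dFF (derivation_conj dFF)) half.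
have [oF _ _ _] := dFF.
set G := (X in derivation X _); set dG := (X in derivation _ X) => dGG.
have dGE A M : (dF A M + conjc (dF (- map_mx conjc A^T) M)) / 2 = dG A M.
  by rewrite /dG mulr0 addr0.
have GE M : G M = (complex.Re (F M))%:C.
  by rewrite /G ReJ_add.
have {dGG}[oG odG lG qG] := dGG.
have bf : forall K : R, exists L : R, forall x : R, `|x| <= K -> `|f x| <= L.
  by move=> K; have [L HL] := Hf K; exists L => x xK; have [] := HL x x xK xK.
have bf' : forall K : R, exists L : R, forall x : R, `|x| <= K -> `|f' x| <= L.
  by move=> K; have [L HL] := Hf K; exists L => x xK; have [] := HL x x xK xK.
have of' := observable_comp_Re mf' bf' oF.
split.
- exact: observable_comp_Re.
- move=> A; under [X in observable X]eq_fun do rewrite dGE.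
  exact: observableM.
- by move=> c A B M; rewrite !dGE lG; ring.
move=> q hq; have [K GK] := qG q hq.
have [L L0 GL] := diffable_lipschitz (odG ('i *: q)) (qG q hq).
have [_ [B FB]] := oF; have [D HD] := Hf B.
exists (D * L ^+ 2 + D * K) => M t gM t01; cbv beta; rewrite dGE.
have gM' := cse_space_flow hq t01 gM.
have := GK M t gM t01; have := GL M t gM t01; rewrite !GE.
have := le_trans (normc_ge_absRe _) (FB M gM).
have := le_trans (normc_ge_absRe _) (FB _ gM').
set y := complex.Re (F (flow q t M)); set x := complex.Re (F M); set e := dG _ _.
move=> yB xB; have [fx f'x rem] := HD x y xB yB.
rewrite -rmorphB normc_real => yx rem'.
have D0 : 0 <= D by exact: le_trans (normr_ge0 _) fx.
have -> : (f y)%:C - (f x)%:C - t%:C * ((f' x)%:C * e) =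
  (f y - f x - f' x * (y - x))%:C + (f' x)%:C * ((y - x)%:C - t%:C * e).
  by rewrite !rmorphB rmorphM !rmorphB /=; ring.
have /andP[t0 t1] := t01.
apply: le_trans (le_normcD _ _) _; rewrite mulrDl lerD//.
  rewrite normc_real; apply: le_trans rem _; rewrite -mulrA ler_wpM2l//.
  rewrite -exprMn -real_normK ?num_real// lerXn2r ?nnegrE ?mulr_ge0//.
by rewrite Normc.normcM normc_real -mulrA ler_pM ?normc_ge0.
Qed.

Lemma observable_sandwich (A B : mat) a b :
  observable (fun M => (A *m M *m B) a b).
Proof.
under [X in observable X]eq_fun do rewrite mxE.
apply: observable_sum => l; apply: observableM; last exact: observable_cst.
under [X in observable X]eq_fun do rewrite mxE.
apply: observable_sum => k; apply: observableM; first exact: observable_cst.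
exact: observable_entry.
Qed.

Lemma derivation_entry a b :
  derivation (fun M => M a b) (fun A M => (A *m M + M *m qdual A) a b).
Proof.
have odF (A : mat) : observable (fun M : mat => (A *m M + M *m qdual A) a b).
  under [X in observable X]eq_fun do rewrite mxE.
  apply: observableD.
    have := observable_sandwich A 1%:M a b.
    by under eq_fun do rewrite mulmx1.
  have := observable_sandwich 1%:M (qdual A) a b.
  by under eq_fun do rewrite mul1mx.
split => //; first exact: observable_entry.
  move=> c A B M; rewrite qdualD qdualZ mulmxDl mulmxDr -scalemxAl -scalemxAr.
  rewrite addrACA -scalerDr.
  have mxD (X Y : mat) : (X + Y) a b = X a b + Y a b by rewrite mxE.
  have mxZ (X : mat) : (c *: X) a b = c * X a b by rewrite mxE.
  by rewrite mxD mxZ.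
move=> q hq; have [_ [K HK]] := odF q.
have [_ [L HL]] := observable_sandwich q (qdual q) a b.
exists (`|K| + 2 * `|L|) => M t gM t01; cbv beta.
have [p1 p2] := unit_phase_taylor t01.
set z := unit_phase t in p1 p2.
(* The flow is a polynomial of degree 2 in z - 1. Its linear coefficient is compared with ['i * t],
   and the quadratic term is itself of order t^2. *)
have -> : flow q t M a b - M a b - t%:C * ('i *: q *m M + M *m qdual ('i *: q)) a b =
  (z - 1 - 'i * t%:C) * (q *m M + M *m qdual q) a b
  + (z - 1) ^+ 2 * (q *m M *m qdual q) a b.
  have -> : flow q t M = M + (z - 1) *: (q *m M + M *m qdual q)
      + (z - 1) ^+ 2 *: (q *m M *m qdual q).
    rewrite /flow /phase_mx -/z qdualD qdualZ qdual_scalar.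
    rewrite mulmxDl mul1mx mulmxDr mulmx1 mulmxDl -!scalemxAr -!scalemxAl scalerA.
    by rewrite -expr2 scalerDr !addrA.
  rewrite qdualZ -scalemxAl -scalemxAr -scalerDr.
  have mxZ c (X : mat) : (c *: X) a b = c * X a b by rewrite mxE.
  have mxD (X Y : mat) : (X + Y) a b = X a b + Y a b by rewrite mxE.
  by rewrite mxZ mxD mxD !mxZ; ring.
move: {p2}((z - 1) ^+ 2) p2 => y p2.
apply: le_trans (le_normcD _ _) _; rewrite !Normc.normcM mulrDl lerD//.
  rewrite mulrC ler_pM ?normc_ge0//.
  exact: le_trans (HK M gM) (ler_norm _).
have -> : 2 * `|L| * t ^+ 2 = 2 * t ^+ 2 * `|L| by ring.
rewrite ler_pM ?normc_ge0//; exact: le_trans (HL M gM) (ler_norm _).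
Qed.

Lemma derivation_sum I (r : seq I) (F : I -> mat -> C) (dF : I -> mat -> mat -> C) :
  (forall i, derivation (F i) (dF i)) ->
  derivation (fun M => \sum_(i <- r) F i M) (fun A M => \sum_(i <- r) dF i A M).
Proof.
move=> h; elim: r => [|i r IH].
  under eq_fun do rewrite big_nil.
  under [X in derivation _ X]eq_fun do under eq_fun do rewrite big_nil.
  exact: derivation_cst.
under eq_fun do rewrite big_cons.
under [X in derivation _ X]eq_fun do under eq_fun do rewrite big_cons.
exact: derivationD.
Qed.

Definition mx_derivation (Phi : mat -> mat) (dPhi : mat -> mat -> mat) :=
  forall a b, derivation (fun M => Phi M a b) (fun A M => dPhi A M a b).

Lemma mx_derivation_id : mx_derivation id (fun A M => A *m M + M *m qdual A).
Proof. by move=> a b; exact: derivation_entry. Qed.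

Lemma mx_derivationM Phi dPhi Psi dPsi :
  mx_derivation Phi dPhi -> mx_derivation Psi dPsi ->
  mx_derivation (fun M => Phi M *m Psi M)
    (fun A M => dPhi A M *m Psi M + Phi M *m dPsi A M).
Proof.
move=> h1 h2 a b.
have := derivation_sum (index_enum _) (fun k => derivationM (h1 a k) (h2 k b)).
congr derivation; first by apply/funext => M; rewrite mxE.
apply/funext => A; apply/funext => M.
by rewrite [RHS]mxE [X in _ = X + _]mxE [X in _ = _ + X]mxE big_split.
Qed.

Lemma derivation_trace Phi dPhi : mx_derivation Phi dPhi ->
  derivation (fun M => \tr (Phi M)) (fun A M => \tr (dPhi A M)).
Proof. by move=> h; apply: derivation_sum => i; exact: h. Qed.

Section by_parts.
Context {d : measure_display} {T : measurableType d}.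
Variables (P : probability T R) (g : T -> mat).
Hypothesis gE : circular_symplectic_ensemble P g.
Local Notation E := (expect P g).

Lemma expect_derivation F dF : derivation F dF -> forall A, E (dF A) = 0.
Proof.
move=> [oF odF lF qF]; apply: herm_proj_span => [c A B|q hq].
  rewrite -(expectZ gE)// -(expectD gE)//; last first.
    by apply: observableM => //; exact: observable_cst.
  by congr (E _); apply/funext => M; rewrite lF.
(* The flow has the skew-Hermitian generator ['i *: q]; complex linearity removes the factor
   ['i]. *)
suff iq0 : E (dF ('i *: q)) = 0.
  have : E (fun M => 'i * dF q M) = 0.
    rewrite -iq0; congr (E _); apply/funext => M.
    have dF0 : dF 0 M = 0.
      apply: (addrI (dF 0 M)); have := lF 1 0 0 M.
      by rewrite scaler0 !addr0 mul1r => <-.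
    by have := lF 'i q 0 M; rewrite addr0 dF0 addr0 => ->.
  rewrite (expectZ gE)// => /eqP; rewrite mulf_eq0 => /orP[|/eqP//].
  by rewrite eq_complex /= oner_eq0 andbF.
have [K FK] := qF q hq.
(* In the mean of F(flow) - F - t dF the first two terms cancel by invariance, while pointwise the
   whole is at most [K * t ^+ 2]. *)
have key t : 0 <= t <= 1 -> `|t * complex.Re (E (dF ('i *: q)))| <= K * t ^+ 2 /\
    `|t * complex.Im (E (dF ('i *: q)))| <= K * t ^+ 2.
  move=> t01; have uu := phase_mx_unitary hq t01.
  have oFu := observable_act uu oF.
  have ot : observable (fun M => (- t%:C) * dF ('i *: q) M).
    by apply: observableM => //; exact: observable_cst.
  have om : observable (fun M => (-1) * F M).
    by apply: observableM => //; exact: observable_cst.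
  pose H M := F (flow q t M) + (-1) * F M + (- t%:C) * dF ('i *: q) M.
  have oH : observable H by apply: observableD => //; exact: observableD.
  have HE : E H = - (t%:C * E (dF ('i *: q))).
    rewrite /H (expectD gE) //; last exact: observableD.
    rewrite (expectD gE)// (expectZ gE)// (expectZ gE)//.
    by rewrite (expect_invariant gE)//; ring.
  have := le_norm_expect gE oH (K := K * t ^+ 2).
  rewrite HE; case: (E _) => x y /=; rewrite !mul0r subr0 addr0 !normrN; apply.
  by move=> M gM; rewrite /H mulN1r mulNr; exact: FK.
have lim (x : R) : (forall t, 0 <= t <= 1 -> `|t * x| <= K * t ^+ 2) -> x = 0.
  move=> h; apply/eqP; rewrite -normr_le0 leNgt; apply/negP => x0.
  have K0 : `|x| <= K by have := h 1; rewrite ler01 lexx mul1r expr1n mulr1; apply.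
  have Kx : 0 < K by exact: lt_le_trans K0.
  (* The case t = 1 gave |x| <= K, so this t is admissible. It makes K t = |x| / 2, against |x| <= K
     t. *)
  pose t := `|x| / (2 * K).
  have t0 : 0 < t by rewrite divr_gt0// mulr_gt0.
  have t1 : t <= 1 by rewrite ler_pdivrMr ?mulr_gt0// mul1r; lra.
  have := h t; rewrite (ltW t0) t1 => /(_ isT).
  rewrite normrM gtr0_norm// expr2 mulrCA ler_pM2l// /t mulrA.
  have -> : K * `|x| / (2 * K) = `|x| / 2 by field; rewrite gt_eqF.
  lra.
apply/eqP; rewrite eq_complex /=; apply/andP; split; apply/eqP; apply: lim => t t01;
  by have [] := key t t01.
Qed.

End by_parts.

End derivation.

(** * Trace identities obtained by integration by parts *)

Section divergence.
Local Open Scope complex_scope.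
Context {R : realType} (n : nat).
Local Notation C := R[i].
Local Notation mat := 'M[C]_(n + n).
Context {d : measure_display} {T : measurableType d}.
Variables (P : probability T R) (g : T -> mat).
Hypothesis gE : circular_symplectic_ensemble P g.
Local Notation E := (expect P g).
Local Notation "A ^H" := (map_mx conjc A^T) (at level 8).

(** A divergence theorem for the field [H * Phi]: the derivation of its entry (k, j) along E_kj has
    mean zero, and these equations are summed. *)
Lemma expect_divergence H dH Phi dPhi :
  derivation H dH -> mx_derivation Phi dPhi ->
  E (fun M : mat => \sum_k \sum_j dH (delta_mx k j) M * Phi M k j
     + H M * \sum_k \sum_j dPhi (delta_mx k j) M k j) = 0.
Proof.
move=> hH hPhi.
have hd k j := derivationM hH (hPhi k j).
transitivity (E (fun M => \sum_k \sum_j (dH (delta_mx k j) M * Phi M k j +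
    H M * dPhi (delta_mx k j) M k j))).
  apply: (eq_expect gE) => M _.
  rewrite mulr_sumr -big_split; apply: eq_bigr => k _.
  by rewrite mulr_sumr -big_split.
have od k j : observable (fun M => dH (delta_mx k j) M * Phi M k j +
    H M * dPhi (delta_mx k j) M k j).
  by have [_ od _ _] := hd k j; exact: od.
rewrite (expect_sum gE); last by move=> k; apply: observable_sum => j; exact: od.
apply: big1 => k _; rewrite (expect_sum gE)//.
by apply: big1 => j _; exact: (expect_derivation gE (hd k j)).
Qed.

Lemma cse_conjK (M : mat) : cse_space M -> M ^H *m M = 1%:M.
Proof.
move=> [/unitarymxP MM _]; apply: mulmx1C; exact: MM.
Qed.

Lemma conj_mxtrace (X : mat) : conjc (\tr X) = \tr (X ^H).
Proof. by rewrite /mxtrace rmorph_sum; apply: eq_bigr => i _; rewrite !mxE. Qed.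

(** Brings the conjugate terms produced by [derivation_conj] into the form Tr(A Y), visibly linear
    in [A], so that they can be contracted with E_kj. *)
Lemma conj_trace_skew (A X : mat) : conjc (\tr ((- A ^H) *m X)) = - \tr (A *m X ^H).
Proof.
rewrite mulNmx linearN /=.
have -> : conjc (- \tr (A ^H *m X)) = - conjc (\tr (A ^H *m X)) by exact: rmorphN.
rewrite conj_mxtrace mx_conjM mxtrace_mulC; congr (- \tr (_ *m _)).
by apply/matrixP => i j; rewrite !mxE conjcK.
Qed.

(** For self-dual M, M A^D = (A M)^D has the trace of A M. The resulting factor 2 cancels the 1/2 of
    the real part in the identities below. *)
Lemma mxtrace_der1 (A M : mat) : qdual M = M ->
  \tr (A *m M + M *m qdual A) = 2 * \tr (A *m M).
Proof.
move=> MD; rewrite linearD /=.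
have -> : \tr (M *m qdual A) = \tr (A *m M).
  by rewrite -{1}MD -qdualM mxtrace_qdual.
by rewrite mulr_natl mulr2n.
Qed.

Lemma mxtrace_der2 (A M : mat) : qdual M = M ->
  \tr ((A *m M + M *m qdual A) *m M + M *m (A *m M + M *m qdual A)) =
  4 * \tr (A *m (M *m M)).
Proof.
move=> MD; rewrite linearD /= [X in _ + X]mxtrace_mulC -mulr2n.
have MMD : qdual (M *m M) = M *m M by rewrite qdualM MD.
have -> : \tr ((A *m M + M *m qdual A) *m M) = 
    \tr (A *m (M *m M) + (M *m M) *m qdual A).
  rewrite mulmxDl !linearD /= -mulmxA; congr (_ + _).
  by rewrite mxtrace_mulC mulmxA.
by rewrite mxtrace_der1//; move: (\tr _) => x; ring.
Qed.

(** The field is M itself. The gradient of f(s Re Tr M) paired with M gives Tr(M^2) - Tr(M^H M),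
    where the second trace is N by unitarity. The divergence of M is N Tr M from A M and - Tr M from
    M A^D. *)
Lemma trace_identity f f' (s : R) : smooth11 f f' ->
  E (fun M : mat =>
    (f' (complex.Re (s%:C * \tr M)) * s)%:C * (\tr (M *m M) - (n + n)%:R) +
    (f (complex.Re (s%:C * \tr M)))%:C * (((n + n)%:R - 1) * \tr M)) = 0.
Proof.
move=> sf.
have dtr := derivationM (derivation_cst n s%:C)
  (derivation_trace (@mx_derivation_id R n)).
rewrite -(expect_divergence (derivation_comp_Re sf dtr) (@mx_derivation_id R n)).
apply: (eq_expect gE) => M gM; have [_ MD] := gM.
congr (_ + _ * _).
  set a := f' _; set h := \sum_k _.
  have -> : h = \sum_k \sum_j (a * s)%:C *
      ((\tr (delta_mx k j *m M) - \tr (delta_mx k j *m M ^H)) * M k j).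
    apply: eq_bigr => k _; apply: eq_bigr => j _.
    transitivity (a%:C * ((0 * \tr M + s%:C * (2 * \tr ((delta_mx k j : mat) *m M)) +
        conjc (0 * \tr M + s%:C * (2 * \tr ((- (delta_mx k j) ^H) *m M)))) / 2)
        * M k j).
      congr (_ * ((_ + _ * _ + conjc (_ + _ * _)) / 2) * _).
        exact: (mxtrace_der1 (delta_mx k j) MD).
      exact: (mxtrace_der1 (- (delta_mx k j) ^H) MD).
    rewrite !mul0r !add0r.
    have -> : conjc (s%:C * (2 * \tr ((- (delta_mx k j) ^H) *m M))) =
        s%:C * (2 * conjc (\tr ((- (delta_mx k j) ^H) *m M))).
      have cM (x y : C) : conjc (x * y) = conjc x * conjc y by exact: rmorphM.
      by rewrite !cM conjc_real conjc_nat.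
    rewrite conj_trace_skew -/a [(a * s)%:C]rmorphM /=.
    move: (\tr _) (\tr _) (M k j) (a%:C) (s%:C) => x y z a' s'.
    by field.
  under eq_bigr do rewrite -mulr_sumr.
  rewrite -mulr_sumr; congr (_ * _).
  under eq_bigr do under eq_bigr do rewrite mulrBl.
  under eq_bigr do rewrite sumrB.
  by rewrite sumrB !contract_trace_delta cse_conjK// mxtrace1.
under eq_bigr do under eq_bigr do rewrite mxE.
under eq_bigr do rewrite big_split.
rewrite big_split /=.
have -> : \sum_(k < n + n) \sum_(j < n + n) ((delta_mx k j : mat) *m M) k j =
    (n + n)%:R * \tr M.
  transitivity (\sum_(k < n + n) \sum_(j < n + n)
    (1%:M *m (delta_mx k j : mat) *m M) k j).
    by apply: eq_bigr => k _; apply: eq_bigr => j _; rewrite mul1mx.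
  by rewrite contract_delta mxtrace1.
have -> : \sum_k \sum_j (M *m qdual (delta_mx k j)) k j = - \tr M.
  transitivity (\sum_k \sum_j (M *m qdual (delta_mx k j) *m 1%:M) k j).
    by apply: eq_bigr => k _; apply: eq_bigr => j _; rewrite mulmx1.
  by rewrite contract_qdual_delta qdual_scalar mulmx1.
by rewrite mulrBl mul1r.
Qed.

(** The same computation for the field M^2 and the scalar Re Tr(M^2). It will bound the second
    moment of Re Tr(M^2) because that square enters with the large coefficient N - 2. *)
Lemma trace2_identity :
  E (fun M : mat => 2 * (\tr ((M *m M) *m (M *m M)) - (n + n)%:R) +
    (complex.Re (\tr (M *m M)))%:C *
      (((n + n)%:R - 2) * \tr (M *m M) + \tr M * \tr M)) = 0.
Proof.
have d2 := mx_derivationM (@mx_derivation_id R n) (@mx_derivation_id R n).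
have dR := derivation_comp_Re (@smooth11_id R) (derivation_trace d2).
rewrite -(expect_divergence dR d2).
apply: (eq_expect gE) => M gM; have [Mu MD] := gM.
have MM : (M *m M) ^H *m (M *m M) = 1%:M.
  by rewrite mx_conjM -mulmxA [M ^H *m (M *m M)]mulmxA cse_conjK// mul1mx cse_conjK.
congr (_ + _ * _).
  set h := \sum_k _.
  have -> : h = \sum_(k < n + n) \sum_(j < n + n) 2 *
      ((\tr ((delta_mx k j : mat) *m (M *m M))
        - \tr ((delta_mx k j : mat) *m (M *m M) ^H)) * (M *m M) k j).
    apply: eq_bigr => k _; apply: eq_bigr => j _.
    transitivity (1%:C * ((4 * \tr ((delta_mx k j : mat) *m (M *m M)) +
        conjc (4 * \tr ((- (delta_mx k j) ^H) *m (M *m M)))) / 2) * (M *m M) k j).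
      congr (_ * ((_ + conjc _) / 2) * _).
        exact: (mxtrace_der2 (delta_mx k j) MD).
      exact: (mxtrace_der2 (- (delta_mx k j) ^H) MD).
    have -> : conjc (4 * \tr ((- (delta_mx k j) ^H) *m (M *m M))) =
        4 * conjc (\tr ((- (delta_mx k j) ^H) *m (M *m M))).
      have cM (x y : C) : conjc (x * y) = conjc x * conjc y by exact: rmorphM.
      by rewrite cM conjc_nat.
    rewrite conj_trace_skew rmorph1 mul1r.
    move: (\tr _) (\tr _) ((M *m M) k j) => x y z.
    by field.
  under eq_bigr do rewrite -mulr_sumr.
  rewrite -mulr_sumr; congr (_ * _).
  under eq_bigr do under eq_bigr do rewrite mulrBl.
  under eq_bigr do rewrite sumrB.
  by rewrite sumrB !contract_trace_delta MM mxtrace1.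
(* The four terms of the derivative of M^2 contribute, in this order, N Tr(M^2), - Tr(M^2), (Tr M)^2
   and - Tr(M^2). *)
transitivity (\sum_(k < n + n) \sum_(j < n + n)
   ((1%:M *m (delta_mx k j : mat) *m (M *m M)) k j
   + (M *m qdual (delta_mx k j : mat) *m M) k j
   + (M *m (delta_mx k j : mat) *m M) k j
   + ((M *m M) *m qdual (delta_mx k j : mat) *m 1%:M) k j)).
  under eq_bigr do rewrite !big_split.
  rewrite !big_split /= !contract_delta !contract_qdual_delta qdual_scalar.
  rewrite MD mulmx1 mxtrace1.
  by move: (\tr _) (\tr _) => x y; ring.
apply: eq_bigr => k _; apply: eq_bigr => j _.
rewrite mul1mx mulmx1 mulmxDl mulmxDr !mulmxA.
have mxD (X Y : mat) : (X + Y) k j = X k j + Y k j by rewrite mxE.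
by rewrite !mxD !addrA.
Qed.

End divergence.

(** * Real observables and moments *)

Section real_observables.
Local Open Scope complex_scope.
Context {R : realType} (n : nat).
Local Notation C := R[i].
Local Notation mat := 'M[C]_(n + n).
Implicit Types X Y : mat -> R.

Definition robservable X := observable (fun M => (X M)%:C).

Lemma robservableP X :
  measurable_fun setT (X : borel_mx R (n + n) -> R) ->
  (exists K : R, forall M, cse_space M -> `|X M| <= K) -> robservable X.
Proof.
move=> mX [K XK]; split; first by split => //; exact: measurable_cst.
by exists K => M gM; rewrite normc_real; exact: XK.
Qed.

Lemma robservable_cst (c : R) : robservable (fun=> c).
Proof. exact: observable_cst. Qed.

Lemma robservableD X Y : robservable X -> robservable Y ->
  robservable (fun M => X M + Y M).
Proof.
move=> oX oY; have := observableD oX oY.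
by congr observable; apply/funext => M; rewrite rmorphD.
Qed.

Lemma robservableM X Y : robservable X -> robservable Y ->
  robservable (fun M => X M * Y M).
Proof.
move=> oX oY; have := observableM oX oY.
by congr observable; apply/funext => M; rewrite rmorphM.
Qed.

Lemma robservable_comp (f : R -> R) X : measurable_fun setT f ->
  (forall K : R, exists L : R, forall x : R, `|x| <= K -> `|f x| <= L) ->
  robservable X -> robservable (fun M => f (X M)).
Proof. by move=> mf bf oX; exact: (observable_comp_Re mf bf oX). Qed.

Lemma robservable_Re (F : mat -> C) : observable F ->
  robservable (fun M => complex.Re (F M)).
Proof.
move=> oF; apply: (observable_comp_Re (f := id) _ _ oF); first exact: measurable_id.
by move=> K; exists K.
Qed.

Lemma robservable_Im (F : mat -> C) : observable F ->
  robservable (fun M => complex.Im (F M)).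
Proof.
move=> oF; have := robservable_Re (observableM oF (observable_cst n (- 'i))).
congr robservable; apply/funext => M; case: (F M) => a b /=; ring.
Qed.

Lemma robservable_norm X : robservable X -> robservable (fun M => `|X M|).
Proof.
apply: (@robservable_comp Num.norm) => //.
by move=> K; exists K => x xK; rewrite normr_id.
Qed.

Context {d : measure_display} {T : measurableType d}.
Variables (P : probability T R) (g : T -> mat).
Hypothesis gE : circular_symplectic_ensemble P g.

Definition mean X : R := \int[P]_w X (g w).

Lemma mean_integrable X : robservable X ->
  P.-integrable setT (EFin \o (fun w => X (g w))).
Proof. exact: (observable_Re_integrable gE). Qed.

Lemma eq_mean X Y : (forall M, cse_space M -> X M = Y M) -> mean X = mean Y.
Proof.
move=> XY; have [gC _ _] := gE.
by apply: eq_Rintegral => w _; rewrite XY.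
Qed.

Lemma meanD X Y : robservable X -> robservable Y ->
  mean (fun M => X M + Y M) = mean X + mean Y.
Proof. by move=> oX oY; rewrite /mean -RintegralD//; exact: mean_integrable. Qed.

Lemma meanZ c X : robservable X -> mean (fun M => c * X M) = c * mean X.
Proof. by move=> oX; rewrite /mean -RintegralZl//; exact: mean_integrable. Qed.

Lemma mean_cst c : mean (fun=> c) = c.
Proof.
rewrite /mean Rintegral_cst// -[RHS]mulr1; congr (_ * _).
exact: (congr1 fine (probability_setT P)).
Qed.

Lemma le_mean X Y : robservable X -> robservable Y ->
  (forall M, cse_space M -> X M <= Y M) -> mean X <= mean Y.
Proof.
move=> oX oY XY; have [gC _ _] := gE.
exact: (le_Rintegral measurableT (mean_integrable oX) (mean_integrable oY)
  (fun w _ => XY _ (gC w))).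
Qed.

Lemma le_norm_mean X : robservable X -> `|mean X| <= mean (fun M => `|X M|).
Proof.
by move=> oX; exact: (le_normr_Rintegral measurableT (mean_integrable oX)).
Qed.

Lemma mean_Re_expect F : complex.Re (expect P g F) = mean (fun M => complex.Re (F M)).
Proof. by []. Qed.

Lemma mean_invariant X u : robservable X -> u \is unitarymx ->
  mean (fun M => X (u *m M *m qdual u)) = mean X.
Proof.
by move=> oX uu; exact: (congr1 (@complex.Re R) (expect_invariant gE oX uu)).
Qed.

Lemma observable_trace (Phi : mat -> mat) :
  (forall a b, observable (fun M => Phi M a b)) -> observable (fun M => \tr (Phi M)).
Proof. by move=> oPhi; apply: observable_sum => i. Qed.

Lemma observable_mulmx (Phi Psi : mat -> mat) :
  (forall a b, observable (fun M => Phi M a b)) ->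
  (forall a b, observable (fun M => Psi M a b)) ->
  forall a b, observable (fun M => (Phi M *m Psi M) a b).
Proof.
move=> o1 o2 a b; under eq_fun do rewrite mxE.
by apply: observable_sum => k; exact: observableM.
Qed.

Definition reTr (M : mat) : R := complex.Re (\tr M).
Definition imTr (M : mat) : R := complex.Im (\tr M).
Definition reTr2 (M : mat) : R := complex.Re (\tr (M *m M)).
Definition reTr4 (M : mat) : R := complex.Re (\tr ((M *m M) *m (M *m M))).

Let o1 := observable_trace (@observable_entry R n).
Let om2 := observable_mulmx (@observable_entry R n) (@observable_entry R n).

Lemma robservable_reTr : robservable reTr.
Proof. exact: (robservable_Re o1). Qed.

Lemma robservable_imTr : robservable imTr.
Proof. exact: (robservable_Im o1). Qed.

Lemma robservable_reTr2 : robservable reTr2.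
Proof. exact: (robservable_Re (observable_trace om2)). Qed.

Lemma robservable_reTr4 : robservable reTr4.
Proof. exact: (robservable_Re (observable_trace (observable_mulmx om2 om2))). Qed.

Lemma reTr2_le M : cse_space M -> `|reTr2 M| <= (n + n)%:R.
Proof.
move=> [Mu _]; apply: le_trans (normc_ge_absRe _) _.
exact: (unitary_normc_trace (mul_unitarymx Mu Mu)).
Qed.

Lemma reTr4_le M : cse_space M -> `|reTr4 M| <= (n + n)%:R.
Proof.
move=> [Mu _]; apply: le_trans (normc_ge_absRe _) _.
have M2 := mul_unitarymx Mu Mu.
exact: (unitary_normc_trace (mul_unitarymx M2 M2)).
Qed.

Lemma smooth11_bounded (f f' : R -> R) : smooth11 f f' ->
  (forall K : R, exists L : R, forall x : R, `|x| <= K -> `|f x| <= L) /\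
  (forall K : R, exists L : R, forall x : R, `|x| <= K -> `|f' x| <= L).
Proof.
by move=> [_ _ Hf]; split => K; have [L HL] := Hf K; exists L => x xK;
  have [] := HL x x xK xK.
Qed.

Hypothesis n_gt0 : (0 < n)%N.
Let N : R := (n + n)%:R.
Let s : R := Num.sqrt (1 - (2 * n%:R)^-1).
(** The W of the statement: the matrix trace counts every eigenvalue twice, which accounts for
    adding the complex conjugate. *)
Definition cseW (M : mat) : R := Num.sqrt (1 - (2 * n%:R)^-1) * reTr M.

Let N_ge2 : 2 <= N.
Proof. by rewrite ler_nat addnn -[2%N]/(1.*2)%N leq_double. Qed.

Let s2 : s ^+ 2 = (N - 1) / N.
Proof.
have N2 := N_ge2; rewrite /s.
have -> : 2 * n%:R = N by rewrite /N natrD mulr_natl mulr2n.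
rewrite sqr_sqrtr; last by rewrite subr_ge0 invf_le1//; lra.
by field; rewrite gt_eqF//; lra.
Qed.

Lemma robservable_cseW : robservable cseW.
Proof. exact: (robservableM (robservable_cst _) robservable_reTr). Qed.

Lemma stein_identity (f f' : R -> R) : smooth11 f f' ->
  mean (fun M => f' (cseW M) * (1 - reTr2 M / N) - cseW M * f (cseW M)) = 0.
Proof.
move=> sf; have [mf mf' _] := sf; have [bf bf'] := smooth11_bounded sf.
have N2 := N_ge2.
have N1 : N - 1 != 0 by rewrite gt_eqF//; lra.
have N0 : N != 0 by rewrite gt_eqF//; lra.
have oW := robservable_cseW.
have := congr1 (@complex.Re R) (trace_identity gE s sf).
rewrite mean_Re_expect /= => key.
(* Multiplying [trace_identity] by this factor turns s Tr M into W, and s^2 / (N - 1) = 1 / N. *)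
have -> : 0 = - s / (N - 1) * 0 by rewrite mulr0.
rewrite -[X in _ = _ * X]key -meanZ; last first.
  apply: robservable_Re; apply: observableD.
    apply: observableM; last first.
      by apply: observableD; [exact: (observable_trace om2)|exact: observable_cst].
    have := observableM (robservable_comp mf' bf' oW) (observable_cst n s%:C).
    congr observable; apply/funext => M; rewrite rmorphM; congr (_%:C * _).
    by rewrite /cseW /reTr -/s; case: (\tr M) => a b /=; rewrite mul0r subr0.
  apply: observableM.
    have := robservable_comp mf bf oW.
    congr observable; apply/funext => M; congr (_%:C).
    by rewrite /cseW /reTr -/s; case: (\tr M) => a b /=; rewrite mul0r subr0.
  by apply: observableM; [exact: observable_cst|exact: o1].
apply: eq_mean => M _.
have -> : complex.Re (s%:C * \tr M) = cseW M.
  by rewrite /cseW /reTr -/s; case: (\tr M) => a b /=; rewrite mul0r subr0.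
have nR : ((n + n)%:R : C) = N%:C by rewrite rmorph_nat.
rewrite nR; move: (f' (cseW M)) (f (cseW M)) => x y.
rewrite /cseW -/s /reTr2 /reTr.
case: (\tr M) => a b; case: (\tr (M *m M)) => a2 b2 /=.
have -> : x * (1 - a2 / N) = - (s ^+ 2) / (N - 1) * (x * (a2 - N)).
  by rewrite s2; move: N N0 N1 => N' N0' N1'; field; rewrite N0' N1'.
move: N N0 N1 => N' N0' N1'; by field.
Qed.

(** With f = id the Stein identity gives E[W^2] = E[1 - Re Tr(M^2) / N], and |Re Tr(M^2)| <= N. *)
Lemma mean_cseW_sqr : mean (fun M => cseW M ^+ 2) <= 2.
Proof.
have N2 := N_ge2.
have oW := robservable_cseW.
have oR : robservable (fun M => 1 - reTr2 M / N).
  apply: robservableD; first exact: robservable_cst.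
  have := robservableM (robservable_cst (- N^-1)) robservable_reTr2.
  by congr robservable; apply/funext => M; ring.
have := stein_identity (@smooth11_id R).
have -> : mean (fun M => 1 * (1 - reTr2 M / N) - cseW M * cseW M) =
  mean (fun M => 1 - reTr2 M / N) - mean (fun M => cseW M ^+ 2).
  rewrite -mulN1r -meanZ; last exact: (robservableM oW oW).
  rewrite -meanD//; last first.
    by apply: robservableM; [exact: robservable_cst|exact: (robservableM oW oW)].
  by apply: eq_mean => M _; ring.
move/eqP; rewrite subr_eq0 => /eqP <-.
rewrite -[leRHS]mean_cst; apply: le_mean => //; first exact: robservable_cst.
move=> M gM; have := reTr2_le gM; rewrite ler_norml => /andP[h _].
have : - 1 <= reTr2 M / N by rewrite ler_pdivlMr ?mulN1r//; lra.
lra.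
Qed.

(* For [z ^+ 2 = 'i], the unitary [u = z] maps [g] to [u g u^D = 'i g]. *)
Lemma mean_imTr_sqr : mean (fun M => imTr M ^+ 2) = mean (fun M => reTr M ^+ 2).
Proof.
pose z : C := sqrtc 'i.
have z2 : z ^+ 2 = 'i by exact: sqr_sqrtc.
have zz : z * conjc z = 1.
  have : `|z| ^+ 2 = 1.
    have : `|z| ^+ 2 ^+ 2 = 1 ^+ 2.
      by rewrite -normrX z2 -normrX sqr_i normrN1 expr1n.
    move/eqP; rewrite eqrXn2 ?ler01 ?exprn_ge0// => /eqP.
    exact.
  by rewrite sqr_normc.
have uz : (z%:M : mat) \is unitarymx.
  apply/unitarymxP; rewrite tr_scalar_mx map_scalar_mx -scalar_mxM.
  by rewrite zz.
have oX := robservableM robservable_reTr robservable_reTr.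
rewrite -[RHS](mean_invariant _ uz)//.
apply: eq_mean => M _.
rewrite qdual_scalar mul_scalar_mx mul_mx_scalar scalerA -expr2 z2.
rewrite /reTr /imTr linearZ /=; case: (\tr M) => a b /=.
by rewrite mul0r mul1r sub0r sqrrN.
Qed.

End real_observables.

(** * Moment bounds and comparison of distribution functions *)

Section moments.
Local Open Scope complex_scope.
Context {R : realType} (n : nat).
Local Notation C := R[i].
Local Notation mat := 'M[C]_(n + n).
Context {d : measure_display} {T : measurableType d}.
Variables (P : probability T R) (g : T -> mat).
Hypothesis gE : circular_symplectic_ensemble P g.
Hypothesis n_ge5 : (5 <= n)%N.
Local Notation E := (mean P g).

Let N : R := (n + n)%:R.
Let n_gt0 : (0 < n)%N. Proof. exact: leq_trans n_ge5. Qed.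

Let N_ge10 : 10 <= N.
Proof. by rewrite ler_nat addnn -[10%N]/(5.*2)%N leq_double. Qed.

Let NE : N = 2 * n%:R. Proof. by rewrite /N natrD mulr_natl mulr2n. Qed.

Lemma mean_reTr_sqr : E (fun M => reTr M ^+ 2) <= 2 * N / (N - 1).
Proof.
have N10 := N_ge10; have := mean_cseW_sqr gE n_gt0.
have oU := @robservable_reTr R n.
have -> : E (fun M => cseW M ^+ 2) = (1 - N^-1) * E (fun M => reTr M ^+ 2).
  rewrite -(meanZ gE); last exact: (robservableM oU oU).
  apply: (eq_mean gE) => M _; rewrite /cseW exprMn sqr_sqrtr -NE//.
  by rewrite subr_ge0 invf_le1//; lra.
move=> h; rewrite ler_pdivlMr; last by lra.
have -> : E (fun M => reTr M ^+ 2) * (N - 1) =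
    N * ((1 - N^-1) * E (fun M => reTr M ^+ 2)).
  by field; rewrite gt_eqF//; lra.
by rewrite [2 * N]mulrC ler_wpM2l//; lra.
Qed.

(** Write Tr M = u + i v and r = Re Tr(M^2). In [trace2_identity] the term r (u^2 - v^2) is
    estimated by N (u^2 + v^2) and the fourth-power trace by N. Since u^2 and v^2 have the same
    mean, at most 2 N / (N - 1), this yields (N - 2) E[r^2] <= 4 N + 4 N^2 / (N - 1). *)
Lemma mean_reTr2_sqr : E (fun M => reTr2 M ^+ 2) <= 12.
Proof.
have N10 := N_ge10.
have oU := @robservable_reTr R n; have oV := @robservable_imTr R n.
have oR := @robservable_reTr2 R n; have oR4 := @robservable_reTr4 R n.
have oU2 := robservableM oU oU; have oV2 := robservableM oV oV.
have oR2 := robservableM oR oR.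
have oc (c : R) : robservable (fun _ : mat => c) := robservable_cst n c.
have := congr1 (@complex.Re R) (trace2_identity gE).
rewrite mean_Re_expect /= => key.
have oZ : robservable (fun M : mat => 2 * (reTr4 M - N) + reTr2 M *
    ((N - 2) * reTr2 M + (reTr M ^+ 2 - imTr M ^+ 2))).
  apply: robservableD.
    by apply: robservableM; [exact: oc|exact: (robservableD oR4 (oc (- N)))].
  apply: robservableM => //; apply: robservableD.
    by apply: robservableM; [exact: oc|].
  apply: robservableD => //.
  have := robservableM (oc (-1)) oV2.
  by congr robservable; apply/funext => M; rewrite mulN1r.
have {}key : E (fun M : mat => 2 * (reTr4 M - N) + reTr2 M *
    ((N - 2) * reTr2 M + (reTr M ^+ 2 - imTr M ^+ 2))) = 0.
  rewrite -key; apply: (eq_mean gE) => M _.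
  have nR : ((n + n)%:R : C) = N%:C by rewrite rmorph_nat.
  rewrite nR /reTr4 /reTr2 /reTr /imTr.
  case: (\tr M) => a b; case: (\tr (M *m M)) => a2 b2; case: (\tr _) => a4 b4 /=.
  by ring.
have oY : robservable (fun M : mat => (N - 2) * (reTr2 M * reTr2 M) +
    ((- N) * (reTr M * reTr M) + ((- N) * (imTr M * imTr M) + - (4 * N)))).
  apply: robservableD; first by apply: robservableM.
  apply: robservableD; first by apply: robservableM.
  by apply: robservableD; first by apply: robservableM.
have : E (fun M : mat => (N - 2) * (reTr2 M * reTr2 M) +
    ((- N) * (reTr M * reTr M) + ((- N) * (imTr M * imTr M) + - (4 * N)))) <= 0.
  rewrite -key; apply: (le_mean gE) => // M gM.
  have := reTr2_le gM; have := reTr4_le gM; rewrite -/N !ler_norml.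
  move: (reTr2 M) (reTr4 M) (reTr M) (imTr M) => r r4 u v /andP[h1 h2] /andP[h3 h4].
  have := mulr_ge0 (sqr_ge0 u) (_ : 0 <= N + r).
  have := mulr_ge0 (sqr_ge0 v) (_ : 0 <= N - r).
  rewrite subr_ge0 h4 -lerBlDl sub0r h3 => /(_ isT) p1 /(_ isT) p2.
  lra.
rewrite !(meanD gE) ?(meanZ gE) ?mean_cst//; last first.
  all: try (by repeat (first [exact: oc | apply: robservableD | apply: robservableM])).
have -> : E (fun M => imTr M * imTr M) = E (fun M => reTr M ^+ 2).
  exact: mean_imTr_sqr.
have := mean_reTr_sqr.
set x := E (fun M => reTr M ^+ 2); set y := E (fun M => reTr2 M ^+ 2).
rewrite ler_pdivlMr; last by lra.
move=> hx hy.
have : (N - 1) * ((N - 2) * y) <= 2 * N * (2 * N) + 4 * N * (N - 1).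
  have : (N - 1) * ((N - 2) * y) <= (N - 1) * (2 * N * x + 4 * N).
    by rewrite ler_wpM2l//; lra.
  have : N * (x * (N - 1)) <= N * (2 * N) by rewrite ler_wpM2l//; lra.
  lra.
move=> h; rewrite -(ler_pM2l (_ : 0 < (N - 1) * (N - 2))); last first.
  by rewrite mulr_gt0//; lra.
rewrite -mulrA; apply: le_trans h _.
(* After clearing denominators this is N^2 - 8 N + 6 >= 0. *)
nra.
Qed.

(** By (|r| - 2)^2 >= 0, |r| <= 1 + r^2 / 4, whose mean is at most 1 + 12 / 4. *)
Lemma mean_norm_reTr2 : E (fun M => `|reTr2 M|) <= 4.
Proof.
have oR := @robservable_reTr2 R n.
have oR2 := robservableM oR oR.
have h := mean_reTr2_sqr.
apply: le_trans (_ : E (fun M => 1 + 4^-1 * reTr2 M ^+ 2) <= _).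
  apply: (le_mean gE).
  - exact: robservable_norm.
  - apply: robservableD; first exact: robservable_cst.
    by apply: robservableM => //; exact: robservable_cst.
  - move=> M _; rewrite -[reTr2 M ^+ 2]real_normK ?num_real//.
    have := sqr_ge0 (`|reTr2 M| - 2); lra.
rewrite (meanD gE) ?(meanZ gE) ?mean_cst//.
- lra.
- exact: robservable_cst.
- by apply: robservableM => //; exact: robservable_cst.
Qed.

Lemma ramp_mean (a b : R) : 0 <= a -> a < b -> b <= Num.sqrt (2 * pi) ->
  `| E (fun M => ramp a b (gauss_int (cseW M))) - (a + b) / 2 / Num.sqrt (2 * pi) |
  <= 4 / n%:R.
Proof.
move=> a0 ab bS.
have N10 := N_ge10.
have sf := smooth11_stein_fun ab.
have [bf bf'] := smooth11_bounded sf.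
have [mf mf' _] := sf.
have oW := @robservable_cseW R n.
have oR := @robservable_reTr2 R n.
have of' := robservable_comp mf' bf' oW.
have ofR := robservableM of' oR.
set m := (a + b) / 2 / _.
have [_ mramp _] := smooth11_ramp_int ab.
have [mI _ _] := @smooth11_gauss_int R.
have oramp : robservable (fun M : mat => ramp a b (gauss_int (cseW M))).
  apply: (robservable_comp (f := fun x => ramp a b (gauss_int x)) _ _ oW).
    exact: (measurableT_comp mramp mI).
  move=> K; exists 1 => x _.
  by rewrite ger0_norm ?ramp_ge0 ?ramp_le1.
have key := stein_identity gE n_gt0 sf.
(* Stein's equation replaces f'(W) - W f(W) by h(W) - m, leaving only the error f'(W) Re Tr(M^2) /
   N. *)
have {}key : E (fun M => ramp a b (gauss_int (cseW M)) +
    (- m + - N^-1 * (stein_fun' a b (cseW M) * reTr2 M))) = 0.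
  rewrite -[RHS]key; apply: (eq_mean gE) => M _.
  rewrite mulrBr mulr1 {2}/stein_fun' -/m -/N.
  by move: (ramp _ _ _) (stein_fun' _ _ _) (stein_fun _ _ _) => x y z; ring.
have omR : robservable (fun M : mat => - N^-1 * (stein_fun' a b (cseW M) * reTr2 M)).
  by apply: robservableM => //; exact: robservable_cst.
rewrite (meanD gE oramp (robservableD (robservable_cst n (- m)) omR)) in key.
rewrite (meanD gE (robservable_cst n (- m)) omR) mean_cst (meanZ gE _ ofR) in key.
have -> : E (fun M => ramp a b (gauss_int (cseW M))) - m =
    N^-1 * E (fun M => stein_fun' a b (cseW M) * reTr2 M) by lra.
have -> : 4 / n%:R = N^-1 * (2 * 4) :> R.
  by rewrite NE; field; rewrite pnatr_eq0 -lt0n n_gt0.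
have N0 : 0 < N by lra.
rewrite normrM gtr0_norm ?invr_gt0// ler_wpM2l ?invr_ge0 ?(ltW N0)//.
apply: le_trans (le_norm_mean gE ofR) _.
apply: le_trans (_ : E (fun M => 2 * `|reTr2 M|) <= _).
  apply: (le_mean gE).
  - exact: robservable_norm.
  - by apply: robservableM; [exact: robservable_cst|exact: robservable_norm].
  - by move=> M _; rewrite normrM ler_wpM2r// stein_fun'_bound.
rewrite (meanZ gE); last exact: robservable_norm.
by rewrite ler_wpM2l// mean_norm_reTr2.
Qed.

Definition cdfW (x0 : R) : R := fine (P [set w | cseW (g w) <= x0]).

Lemma cdfW_mean x0 : cdfW x0 = E (fun M => (cseW M <= x0)%R%:R) /\
  robservable (fun M : mat => ((cseW M <= x0)%R%:R : R)).
Proof.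
have [[mW _] _] := @robservable_cseW R n.
have mg := measurable_ensemble gE.
have mA : measurable [set M : borel_mx R (n + n) | (cseW M <= x0)%R].
  have := mW measurableT `]-oo, x0]%classic (measurable_itv _).
  rewrite setTI; congr measurable; apply/seteqP; split => M /=; by rewrite in_itv.
have indE : (fun M : mat => ((cseW M <= x0)%R%:R : R)) =
    \1_[set M : borel_mx R (n + n) | (cseW M <= x0)%R].
  apply/funext => M; rewrite indicE; congr ((nat_of_bool _)%:R).
  by apply/idP/idP => [h|]; [rewrite mem_set|rewrite inE].
split; last first.
  apply: robservableP.
    by rewrite indE; exact: measurable_indic.
  by exists 1 => M _; case: (cseW M <= x0)%R; rewrite ?normr0 ?normr1.
rewrite /cdfW /mean /Rintegral.
have mB : measurable [set w | (cseW (g w) <= x0)%R].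
  by rewrite -[X in measurable X]setTI; exact: (mg measurableT _ mA).
congr fine; rewrite -[in LHS](setIT [set w | (cseW (g w) <= x0)%R]).
rewrite -integral_indic//; apply: eq_integral => w _.
rewrite indicE; congr ((nat_of_bool _)%:R%:E).
by apply/idP/idP => [|h]; [rewrite inE|rewrite mem_set].
Qed.

(** The indicator of W <= x0 lies between the ramps that descend over [I - e, I] and over [I, I + e]
    in the variable y, where I = [gauss_int x0]. Moving the ramp changes the Gaussian mean by e / (2
    S) only, with S = sqrt(2 pi), and the error 4 / n of [ramp_mean] does not depend on e. *)
Lemma cdfW_gauss x0 :
  `| cdfW x0 - (Num.sqrt (2 * pi))^-1 * gauss_int x0 | <= 4 / n%:R.
Proof.
have [-> oind] := cdfW_mean x0.
have S0 : 0 < Num.sqrt (2 * pi) :> R by rewrite sqrtr_gt0 mulr_gt0// pi_gt0.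
(* Strictness leaves room for a ramp of positive width on either side of [gauss_int x0]. *)
have [I0 IS] : 0 < gauss_int x0 /\ gauss_int x0 < Num.sqrt (2 * pi).
  split.
    apply: le_lt_trans (gauss_int_ge0 (x0 - 1)) _.
    by apply: gauss_int_lt; rewrite gtrBl.
  apply: lt_le_trans (gauss_int_le (x0 + 1)).
  by apply: gauss_int_lt; rewrite ltrDl.
have Ile (y z : R) : (gauss_int y <= gauss_int z) = (y <= z).
  have [|zy] := leP y z.
    by rewrite le_eqVlt => /orP[/eqP ->|/gauss_int_lt/ltW ->//]; rewrite lexx.
  by apply/negbTE; rewrite -ltNge gauss_int_lt.
set I := gauss_int x0 in I0 IS *; set S := Num.sqrt _ in S0 IS *.
set p := E _.
have oramp a b : a < b -> robservable (fun M : mat => ramp a b (gauss_int (cseW M))).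
  move=> ab; have [_ mramp _] := smooth11_ramp_int ab.
  have [mI _ _] := @smooth11_gauss_int R.
  have oW := @robservable_cseW R n.
  apply: (robservable_comp (f := fun x => ramp a b (gauss_int x)) _ _ oW).
    exact: (measurableT_comp mramp mI).
  move=> K; exists 1 => x _.
  by rewrite ger0_norm ?ramp_ge0 ?ramp_le1.
have up (e : R) : 0 < e -> I + e <= S -> p <= S^-1 * I + 4 / n%:R + e / (2 * S).
  move=> e0 eS; have Ie : I < I + e by rewrite ltrDl.
  have := ramp_mean (ltW I0) Ie eS; rewrite ler_norml => /andP[_ h].
  have : p <= E (fun M => ramp I (I + e) (gauss_int (cseW M))).
    apply: (le_mean gE) => //; first exact: oramp.
    move=> M _; case: (leP (cseW M) x0) => [Wx|_] /=; last exact: ramp_ge0.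
    by rewrite ramp_eq1// /I Ile.
  have : (I + (I + e)) / 2 / S = S^-1 * I + e / (2 * S) by field; rewrite gt_eqF.
  rewrite -/S in h; lra.
have lo (e : R) : 0 < e -> 0 <= I - e -> S^-1 * I - 4 / n%:R - e / (2 * S) <= p.
  move=> e0 eS; have Ie : I - e < I by rewrite gtrBl.
  have := ramp_mean eS Ie (ltW IS); rewrite ler_norml => /andP[h _].
  have : E (fun M => ramp (I - e) I (gauss_int (cseW M))) <= p.
    apply: (le_mean gE) => //; first exact: oramp.
    move=> M _; case: (leP (cseW M) x0) => [_|Wx] /=; first exact: ramp_le1.
    by rewrite ramp_eq0// /I Ile ltW.
  have : (I - e + I) / 2 / S = S^-1 * I - e / (2 * S) by field; rewrite gt_eqF.
  rewrite -/S in h; lra.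
have S2 : 0 < 2 * S by rewrite mulr_gt0.
rewrite ler_norml; apply/andP; split; rewrite leNgt; apply/negP => h.
- pose D := S^-1 * I - 4 / n%:R - p.
  have D0 : 0 < D by rewrite /D; lra.
  (* The ramp has to stay in y >= 0, hence [I]; the choice [S * D] makes its cost at most D / 2,
     less than the assumed excess D. *)
  pose e := Num.min I (S * D).
  have e0 : 0 < e by rewrite lt_min I0 mulr_gt0.
  have eI : e <= I by rewrite ge_min lexx.
  have eD : e / (2 * S) <= D / 2.
    rewrite ler_pdivrMr//; apply: le_trans (_ : S * D <= _).
      by rewrite ge_min lexx orbT.
    by rewrite le_eqVlt; apply/orP; left; apply/eqP; field.
  have := lo e e0; rewrite subr_ge0 => /(_ eI); rewrite -/D; rewrite /D in D0 eD *; lra.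
- pose D := p - (S^-1 * I + 4 / n%:R).
  have D0 : 0 < D by rewrite /D; lra.
  pose e := Num.min (S - I) (S * D).
  have e0 : 0 < e by rewrite lt_min subr_gt0 IS mulr_gt0.
  have eI : e <= S - I by rewrite ge_min lexx.
  have eD : e / (2 * S) <= D / 2.
    rewrite ler_pdivrMr//; apply: le_trans (_ : S * D <= _).
      by rewrite ge_min lexx orbT.
    by rewrite le_eqVlt; apply/orP; left; apply/eqP; field.
  have := up e e0; rewrite -lerBrDl => /(_ eI); rewrite /D in D0 eD; lra.
Qed.

End moments.

(** * From the matrix trace to the eigenvalues *)

(** Compares the subleading coefficients of the characteristic polynomial, written as a product over
    the list of eigenvalues repeated twice. *)
Lemma cse_eigenvalues_trace (R : realType) n (g : 'M[R[i]]_(n + n)) (x : 'I_n -> R[i]) :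
  (0 < n)%N -> cse_eigenvalues g x -> \tr g = 2 * \sum_(i < n) x i.
Proof.
move=> n0 gx.
have nn0 : (0 < n + n)%N by rewrite addn_gt0 n0.
apply: oppr_inj; rewrite -(char_poly_trace g nn0) gx.
pose s := [seq x i | i <- index_enum 'I_n].
have sz : size (s ++ s) = (n + n)%N.
  by rewrite size_cat size_map -[index_enum _]enumT size_enum_ord.
have -> : (\prod_(i < n) ('X - (x i)%:P)) ^+ 2 = \prod_(z <- s ++ s) ('X - z%:P).
  by rewrite big_cat /= big_map expr2.
rewrite -sz coefPn_prod_XsubC ?sz -?lt0n//.
by rewrite big_cat /= big_map mulr_natl mulr2n.
Qed.

Lemma cse_W_trace (R : realType) n (g : 'M[R[i]]_(n + n)) (x : 'I_n -> R[i]) :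
  (0 < n)%N -> cse_eigenvalues g x -> cse_W x = cseW g.
Proof.
move=> n0 gx; rewrite /cse_W /cseW /reTr (cse_eigenvalues_trace n0 gx).
congr (_ * _); case: (\sum_i _) => a b /=.
by ring.
Qed.

Theorem theorem4p17 (R : realType) (d : measure_display)
    (T : measurableType d) (P : probability T R) (n : nat)
    (g : T -> 'M[R[i]]_(n + n)) (x : T -> 'I_n -> R[i]) :
  (2 <= n)%N ->
  circular_symplectic_ensemble P g ->
  (forall w, cse_eigenvalues (g w) (x w)) ->
  forall x0 : R,
    `| fine (P [set w | cse_W (x w) <= x0])
       - (Num.sqrt (2 * pi))^-1 *
         (\int[lebesgue_measure]_(t in `]-oo, x0]) expR (- (t ^+ 2 / 2))) |
    <= 4 / n%:R.
Proof.
move=> n2 gE gx x0; have n0 : (0 < n)%N by exact: leq_trans n2.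
have -> : fine (P [set w | cse_W (x w) <= x0]) = cdfW P g x0.
  congr (fine (P _)); apply/funext => w /=.
  by rewrite (cse_W_trace n0 (gx w)).
rewrite -/(gauss_int x0).
have [n5|n4] := leqP 5 n; first exact: cdfW_gauss.
have S0 : 0 < Num.sqrt (2 * pi) :> R by rewrite sqrtr_gt0 mulr_gt0// pi_gt0.
have g0 : 0 <= (Num.sqrt (2 * pi))^-1 * gauss_int x0.
  by rewrite mulr_ge0 ?invr_ge0 ?(ltW S0)// gauss_int_ge0.
have g1 : (Num.sqrt (2 * pi))^-1 * gauss_int x0 <= 1.
  by rewrite mulrC ler_pdivrMr// mul1r gauss_int_le.
have p0 : 0 <= cdfW P g x0 by exact: fine_ge0.
have p1 : cdfW P g x0 <= 1.
  have [-> oX] := cdfW_mean gE x0; rewrite -[leRHS](mean_cst P g 1).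
  apply: (le_mean gE oX (robservable_cst n 1)) => M _.
  by case: (cseW M <= x0)%R; rewrite ?ler01.
have n4' : 1 <= 4 / n%:R :> R.
  by rewrite ler_pdivlMr ?ltr0n// mul1r ler_nat.
apply: le_trans n4'; rewrite ler_norml; apply/andP; split; lra.
Qed.
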